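(* Let $A$ be a ring, let $\Sigma$ be a finitely generated projective right $A$-module which is moreover simple as a right $A$-module, let $B$ be a subring of $S=\mathrm{End}(\Sigma_A)$, and let $\mathfrak{C}=\Sigma^*\otimes_B\Sigma$ be the comatrix $A$-coring. Then for every coideal $J$ of $\mathfrak{C}$ the quotient coring $\mathfrak{C}/J$ is simple cosemisimple. Consequently the maps $$J\mapsto\mathrm{End}(\Sigma_{\mathfrak{C}/J}),\qquad C\mapsto\mathrm{Ker}(\Sigma^*\otimes_B\Sigma\twoheadrightarrow\Sigma^*\otimes_C\Sigma)$$ give a bijective correspondence between the set of all coideals $J$ of $\mathfrak{C}$ and the set of all intermediate division subrings $B\subseteq C\subseteq\mathrm{End}(\Sigma_A)$.
   Context: All rings are associative unital algebras over a fixed commutative ring $K$, and bimodules are centralized by $K$. An $A$-coring is an $A$-bimodule $\mathfrak{C}$ with $A$-bimodule maps $\Delta:\mathfrak{C}\to\mathfrak{C}\otimes_A\mathfrak{C}$ and $\epsilon:\mathfrak{C}\to A$ that are coassociative and counital. A right $\mathfrak{C}$-comodule is a right $A$-module $M$ with a right $A$-linear coassociative and counital coaction $M\to M\otimes_A\mathfrak{C}$; comodule maps are right $A$-linear maps commuting with coactions, and $\mathrm{End}(M_{\mathfrak{C}})$ is the ring of comodule endomorphisms. A coideal $J$ of $\mathfrak{C}$ is the kernel of a surjective homomorphism of $A$-corings out of $\mathfrak{C}$; then $\mathfrak{C}/J$ is an $A$-coring. Comatrix coring: with $\Sigma^*=\mathrm{Hom}_A(\Sigma,A)$ and a finite dual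 basis $\{(e_i^*,e_i)\}$ of $\Sigma_A$, the $A$-bimodule $\Sigma^*\otimes_B\Sigma$ is an $A$-coring via $\Delta(\phi\otimes_Bx)=\sum_i\phi\otimes_Be_i\otimes_Ae_i^*\otimes_Bx$, $\epsilon(\phi\otimes_Bx)=\phi(x)$. $\Sigma$ is a right $\Sigma^*\otimes_B\Sigma$-comodule via $x\mapsto\sum_ie_i\otimes_Ae_i^*\otimes_Bx$, and a right comodule over every quotient coring by composing with the projection. An $A$-coring $\mathfrak{D}$ is cosemisimple if the category of right $\mathfrak{D}$-comodules is abelian and every right $\mathfrak{D}$-comodule is semisimple (equivalently, $\mathfrak{D}$ is semisimple as a right comodule over itself and flat as a left $A$-module). It is simple if it has no nontrivial sub-bicomodules; simple cosemisimple means both. *)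

(* Defs.v *)
From HB Require Import structures.
From mathcomp Require Import all_boot all_order all_algebra.
From mathcomp Require Import boolp classical_sets.

Set Implicit Arguments.
Unset Strict Implicit.
Unset Printing Implicit Defensive.

Import GRing.Theory.
Local Open Scope ring_scope.
Local Open Scope quotient_scope.

Section LinearHom.
Variable R : pzRingType.

Lemma linear_ext (U V : lmodType R) (f g : {linear U -> V}) : f =1 g -> f = g.
Proof.
case: f => f [[mf] [sf]]; case: g => g [[mg] [sg]] /= /funext efg.
case: _ / efg in mg sg *.
by rewrite (Prop_irrelevance mf mg) (Prop_irrelevance sf sg).
Qed.

Section Zmod.
Variables U V : lmodType R.
Implicit Types f g h : {linear U -> V}.

HB.instance Definition _ := gen_eqMixin {linear U -> V}.
HB.instance Definition _ := gen_choiceMixin {linear U -> V}.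

Definition linhom0 : {linear U -> V} := \0.
Definition linhomN f : {linear U -> V} := \- f.
Definition linhomD f g : {linear U -> V} := f \+ g.

Lemma linhomA : associative linhomD.
Proof. by move=> f g h; apply: linear_ext => x /=; rewrite addrA. Qed.
Lemma linhomC : commutative linhomD.
Proof. by move=> f g; apply: linear_ext => x /=; rewrite addrC. Qed.
Lemma linhom0D : left_id linhom0 linhomD.
Proof. by move=> f; apply: linear_ext => x /=; rewrite add0r. Qed.
Lemma linhomND : left_inverse linhom0 linhomN linhomD.
Proof. by move=> f; apply: linear_ext => x /=; rewrite addNr. Qed.

HB.instance Definition _ :=
  GRing.isZmodule.Build {linear U -> V} linhomA linhomC linhom0D linhomND.

Lemma linhom_addE f g x : (f + g) x = f x + g x. Proof. by []. Qed.
Lemma linhom_oppE f x : (- f) x = - f x. Proof. by []. Qed.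
Lemma linhom_zeroE x : (0 : {linear U -> V}) x = 0. Proof. by []. Qed.

End Zmod.

Section Ring.
Variable U : lmodType R.
Implicit Types f g h : {linear U -> U}.

Definition linend1 : {linear U -> U} := idfun.
Definition linendM f g : {linear U -> U} := f \o g.

Lemma linendA : associative linendM.
Proof. by move=> f g h; apply: linear_ext. Qed.
Lemma linend1M : left_id linend1 linendM.
Proof. by move=> f; apply: linear_ext. Qed.
Lemma linendM1 : right_id linend1 linendM.
Proof. by move=> f; apply: linear_ext. Qed.
Lemma linendDl : left_distributive linendM +%R.
Proof. by move=> f g h; apply: linear_ext. Qed.
Lemma linendDr : right_distributive linendM +%R.
Proof. by move=> f g h; apply: linear_ext => x /=; rewrite !linearD. Qed.

HB.instance Definition _ := GRing.Zmodule_isPzRing.Build {linear U -> U}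
  linendA linend1M linendM1 linendDl linendDr.

Lemma linend_mulE f g x : (f * g) x = f (g x). Proof. by []. Qed.
Lemma linend_oneE x : (1 : {linear U -> U}) x = x. Proof. by []. Qed.

End Ring.
End LinearHom.

(* Tensor product of M (with "right action" ra) and N (with "left action" la)
   over a scalar set R.  Elements are finite sums of pure tensors, i.e.
   sequences of pairs, two such sums being identified when no balanced map
   distinguishes them; tlift and its lemmas below give the universal property. *)
Section Tensor.
Variables (R : Type) (M N : zmodType) (ra : M -> R -> M) (la : R -> N -> N).

Definition balanced (P : zmodType) (f : M -> N -> P) : Prop :=
  [/\ forall m m' n, f (m + m') n = f m n + f m' n,
      forall m n n', f m (n + n') = f m n + f m n'
    & forall m r n, f (ra m r) n = f m (la r n)].

Definition tens_eq (s t : seq (M * N)) : bool :=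
  `[< forall (P : zmodType) (f : M -> N -> P), balanced f ->
        \sum_(p <- s) f p.1 p.2 = \sum_(p <- t) f p.1 p.2 >].

Lemma tens_eq_refl : reflexive tens_eq.
Proof. by move=> s; apply/asboolP. Qed.
Lemma tens_eq_sym : symmetric tens_eq.
Proof.
by move=> s t; apply/asboolP/asboolP => h P f bf; rewrite (h P f bf).
Qed.
Lemma tens_eq_trans : transitive tens_eq.
Proof.
move=> t s u /asboolP h1 /asboolP h2; apply/asboolP => P f bf.
by rewrite (h1 P f bf) (h2 P f bf).
Qed.

Canonical tens_equiv := EquivRel tens_eq tens_eq_refl tens_eq_sym tens_eq_trans.

Definition tens : Type := {eq_quot tens_equiv}.
HB.instance Definition _ := Choice.on tens.

Definition tcls (s : seq (M * N)) : tens := \pi_{eq_quot tens_equiv} s.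
Definition trepr (t : tens) : seq (M * N) := repr (t : {eq_quot tens_equiv}).

Lemma treprK t : tcls (trepr t) = t. Proof. exact: reprK. Qed.

Lemma tclsP s t : tcls s = tcls t <->
  forall (P : zmodType) (f : M -> N -> P), balanced f ->
        \sum_(p <- s) f p.1 p.2 = \sum_(p <- t) f p.1 p.2.
Proof.
split=> [/eqmodP /asboolP //|h]; apply/eqmodP; exact/asboolP.
Qed.

Definition tpure (m : M) (n : N) : tens := tcls [:: (m, n)].

(* Meaningful when f is balanced: see tliftE and tlift_zmod_morphism. *)
Definition tlift (P : zmodType) (f : M -> N -> P) (t : tens) : P :=
  \sum_(p <- trepr t) f p.1 p.2.

Lemma tlift_cls (P : zmodType) (f : M -> N -> P) s : balanced f ->
  tlift f (tcls s) = \sum_(p <- s) f p.1 p.2.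
Proof. by move=> bf; apply: (tclsP _ _).1 => //; rewrite treprK. Qed.

Lemma tliftE (P : zmodType) (f : M -> N -> P) m n : balanced f ->
  tlift f (tpure m n) = f m n.
Proof. by move=> bf; rewrite tlift_cls // big_seq1. Qed.

Definition tneg (s : seq (M * N)) := [seq (- p.1, p.2) | p <- s].

Definition tzero : tens := tcls [::].
Definition topp (t : tens) : tens := tcls (tneg (trepr t)).
Definition tadd (t u : tens) : tens := tcls (trepr t ++ trepr u).

Lemma balanced_oppl (P : zmodType) (f : M -> N -> P) m n :
  balanced f -> f (- m) n = - f m n.
Proof.
case=> fD _ _; apply/eqP; rewrite -addr_eq0 -fD addNr; apply/eqP.
by apply: (addrI (f 0 n)); rewrite -fD !addr0.
Qed.

Lemma tcls_eq s u : (forall (P : zmodType) (f : M -> N -> P), balanced f ->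
     \sum_(p <- s) f p.1 p.2 = tlift f u) -> tcls s = u.
Proof.
by move=> h; rewrite -[u]treprK; apply/tclsP => P f bf; rewrite h.
Qed.

Lemma tens_sep t u : (forall (P : zmodType) (f : M -> N -> P), balanced f ->
     tlift f t = tlift f u) -> t = u.
Proof. by move=> h; rewrite -[t]treprK; apply: tcls_eq => P f /h. Qed.

Lemma tlift_add (P : zmodType) (f : M -> N -> P) t u : balanced f ->
  tlift f (tadd t u) = tlift f t + tlift f u.
Proof. by move=> bf; rewrite tlift_cls // big_cat. Qed.

Lemma tlift_opp (P : zmodType) (f : M -> N -> P) t : balanced f ->
  tlift f (topp t) = - tlift f t.
Proof.
move=> bf; rewrite tlift_cls // big_map -sumrN.
by apply: eq_bigr => p _; apply: balanced_oppl.
Qed.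

Lemma tlift_zero (P : zmodType) (f : M -> N -> P) : balanced f ->
  tlift f tzero = 0.
Proof. by move=> bf; rewrite tlift_cls // big_nil. Qed.

Lemma taddA : associative tadd.
Proof.
by move=> t u v; apply: tens_sep => P f bf; rewrite !tlift_add // addrA.
Qed.
Lemma taddC : commutative tadd.
Proof.
by move=> t u; apply: tens_sep => P f bf; rewrite !tlift_add // addrC.
Qed.
Lemma tadd0 : left_id tzero tadd.
Proof.
by move=> t; apply: tens_sep => P f bf; rewrite tlift_add ?tlift_zero ?add0r.
Qed.
Lemma taddN : left_inverse tzero topp tadd.
Proof.
move=> t; apply: tens_sep => P f bf.
by rewrite tlift_add ?tlift_opp ?tlift_zero ?addNr.
Qed.

HB.instance Definition _ := GRing.isZmodule.Build tens taddA taddC tadd0 taddN.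

Lemma tliftD (P : zmodType) (f : M -> N -> P) t u : balanced f ->
  tlift f (t + u) = tlift f t + tlift f u.
Proof. exact: tlift_add. Qed.

Lemma tlift0 (P : zmodType) (f : M -> N -> P) : balanced f -> tlift f 0 = 0.
Proof. exact: tlift_zero. Qed.

Lemma tliftN (P : zmodType) (f : M -> N -> P) t : balanced f ->
  tlift f (- t) = - tlift f t.
Proof. exact: tlift_opp. Qed.

Lemma tlift_zmod_morphism (P : zmodType) (f : M -> N -> P) :
  balanced f -> zmod_morphism (tlift f).
Proof. by move=> bf t u; rewrite tliftD ?tliftN. Qed.

Lemma tlift_sum (P : zmodType) (f : M -> N -> P) I (r : seq I) (F : I -> tens) :
  balanced f -> tlift f (\sum_(i <- r) F i) = \sum_(i <- r) tlift f (F i).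
Proof.
by move=> bf; apply: (big_morph (tlift f)) => [t u|]; rewrite ?tliftD ?tlift0.
Qed.

Lemma tpure_balanced : balanced tpure.
Proof.
split=> [m m' n|m n n'|m r n]; apply: tens_sep => P f bf;
  rewrite ?tliftD ?tliftE //; by case: bf.
Qed.

Lemma tpureDl m m' n : tpure (m + m') n = tpure m n + tpure m' n.
Proof. by case: tpure_balanced. Qed.
Lemma tpureDr m n n' : tpure m (n + n') = tpure m n + tpure m n'.
Proof. by case: tpure_balanced. Qed.
Lemma tpureA m r n : tpure (ra m r) n = tpure m (la r n).
Proof. by case: tpure_balanced. Qed.

Lemma tens_sum t : t = \sum_(p <- trepr t) tpure p.1 p.2.
Proof.
apply: tens_sep => P f bf; rewrite tlift_sum //.
by apply: eq_bigr => p _; rewrite tliftE.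
Qed.

Lemma tens_ind (Q : tens -> Prop) : Q 0 -> (forall t u, Q t -> Q u -> Q (t + u)) ->
  (forall m n, Q (tpure m n)) -> forall t, Q t.
Proof.
move=> Q0 QD Qp t; rewrite (tens_sum t).
by elim/big_ind: _ => // p _; apply: Qp.
Qed.

Lemma tens_fun_eq (P : zmodType) (f g : tens -> P) :
  {morph f : x y / x + y} -> {morph g : x y / x + y} ->
  (forall m n, f (tpure m n) = g (tpure m n)) -> f =1 g.
Proof.
move=> fD gD fg; have z h : {morph h : x y / x + y :> tens >-> x + y} -> h 0 = 0 :> P.
  by move=> hD; apply: (addrI (h 0)); rewrite -hD !addr0.
by apply: tens_ind => [|t u ht hu|//]; rewrite ?(z f) ?(z g) ?fD ?gD ?ht ?hu.
Qed.

End Tensor.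

Arguments tens {R M N}.
Arguments tpure {R M N ra la}.
Arguments tlift {R M N ra la P}.

Section Bimodules.
Variables (K : comPzRingType) (A : algType K).

(* Right A-modules are left modules over the converse ring A^c. *)
Definition ract (M : lmodType A^c) (m : M) (a : A) : M := (a : A^c) *: m.

Lemma ractDl M m m' a : @ract M (m + m') a = ract m a + ract m' a.
Proof. exact: scalerDr. Qed.
Lemma ractDr M m a b : @ract M m (a + b) = ract m a + ract m b.
Proof. exact: scalerDl. Qed.
Lemma ractA M m a b : @ract M (ract m a) b = ract m (a * b).
Proof. exact: scalerA. Qed.
Lemma ract1 M m : @ract M m 1 = m.
Proof. exact: scale1r. Qed.
Lemma ract_lin (M N : lmodType A^c) (f : {linear M -> N}) m a :
  f (ract m a) = ract (f m) a.
Proof. exact: linearZ. Qed.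

(* (A, A)-bimodules, centralized by K. *)
Record bimodule := Bimodule {
  bimod_car :> lmodType A^c;
  lact : A -> bimod_car -> bimod_car;
  lactDr : forall a m m', lact a (m + m') = lact a m + lact a m';
  lactDl : forall a b m, lact (a + b) m = lact a m + lact b m;
  lactA : forall a b m, lact a (lact b m) = lact (a * b) m;
  lact1 : forall m, lact 1 m = m;
  lact_ract : forall a m b, lact a (ract m b) = ract (lact a m) b;
  lact_central : forall (k : K) m, lact k%:A m = ract m k%:A
}.

Record bimodHom (M N : bimodule) := BimodHom {
  bimod_fun :> {linear M -> N};
  bimod_funL : forall a m, bimod_fun (lact a m) = lact a (bimod_fun m)
}.

Definition reg_lact (a : A) (x : (A^c)^o) : (A^c)^o := a * (x : A).

Lemma reg_subproof :
  (forall (k : K) (x : (A^c)^o), reg_lact k%:A x = ract x k%:A).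
Proof.
by move=> k x; rewrite /reg_lact -[RHS]/((x : A) * k%:A) mulr_algl mulr_algr.
Qed.

Definition regbimod : bimodule :=
  @Bimodule (A^c)^o reg_lact
    (fun a x y => mulrDr a (x : A) (y : A))
    (fun a b x => mulrDl a b (x : A))
    (fun a b x => mulrA a b (x : A))
    (fun x => mul1r (x : A))
    (fun a x b => mulrA a (x : A) b)
    reg_subproof.

Definition tensA (M : lmodType A^c) (N : bimodule) : Type :=
  tens (@ract M) (@lact N).
HB.instance Definition _ M N := GRing.Zmodule.on (tensA M N).

Definition tmap (M M' : lmodType A^c) (N N' : bimodule)
    (f : M -> M') (g : N -> N') : tensA M N -> tensA M' N' :=
  tlift (fun m n => tpure (f m) (g n)).

Section Tmap.
Variables (M M' : lmodType A^c) (N N' : bimodule) (f : M -> M') (g : N -> N').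
Hypotheses (fD : {morph f : x y / x + y}) (gD : {morph g : x y / x + y}).
Hypotheses (fA : forall m a, f (ract m a) = ract (f m) a).
Hypotheses (gA : forall n a, g (lact a n) = lact a (g n)).

Lemma tmap_balanced : balanced (@ract M) (@lact N)
  (fun m n => tpure (f m) (g n) : tensA M' N').
Proof.
split=> [m m' n|m n n'|m a n].
- by rewrite fD; apply: tpureDl.
- by rewrite gD; apply: tpureDr.
- by rewrite fA gA; apply: tpureA.
Qed.

Lemma tmapE m n : tmap f g (tpure m n) = tpure (f m) (g n).
Proof. exact: (tliftE _ _ tmap_balanced). Qed.

Lemma tmapD : {morph tmap f g : x y / x + y}.
Proof. move=> x y; exact: (tliftD _ _ tmap_balanced). Qed.
End Tmap.

Lemma tensA_eq (M : lmodType A^c) (N : bimodule) (P : zmodType)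
    (f g : tensA M N -> P) :
  {morph f : x y / x + y} -> {morph g : x y / x + y} ->
  (forall m n, f (tpure m n) = g (tpure m n)) -> f =1 g.
Proof. exact: tens_fun_eq. Qed.

Section TensRight.
Variables (M : lmodType A^c) (N : bimodule).

Definition tensA_scale (a : A^c) : tensA M N -> tensA M N :=
  tmap id (fun n => ract n a).

Lemma tensA_scale_balanced (a : A^c) : balanced (@ract M) (@lact N)
  (fun m n => tpure m (ract n a) : tensA M N).
Proof.
by apply: (@tmap_balanced M M N N id (fun n => ract n a))
  => // [x y|n b]; rewrite ?ractDl ?lact_ract.
Qed.
#[local] Hint Resolve tensA_scale_balanced : core.

Lemma tensA_scaleE a m n : tensA_scale a (tpure m n) = tpure m (ract n a).
Proof. exact: (tliftE _ _ (tensA_scale_balanced a)). Qed.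
Lemma tensA_scaleD a : {morph tensA_scale a : x y / x + y}.
Proof. move=> x y; exact: (tliftD _ _ (tensA_scale_balanced a)). Qed.

Lemma tensA_scaleA (a b : A^c) v :
  tensA_scale a (tensA_scale b v) = tensA_scale (a * b) v.
Proof.
apply: (@tensA_eq M N _ (tensA_scale a \o tensA_scale b) (tensA_scale (a * b))).
- by move=> x y /=; rewrite !tensA_scaleD.
- exact: tensA_scaleD.
- by move=> m n /=; rewrite !tensA_scaleE ractA.
Qed.
Lemma tensA_scale1 : left_id 1 tensA_scale.
Proof.
apply: (@tensA_eq M N _ (tensA_scale 1) id) => [||m n] //.
- exact: tensA_scaleD.
- by rewrite tensA_scaleE ract1.
Qed.
Lemma tensA_scaleDr : right_distributive tensA_scale +%R.
Proof. exact: tensA_scaleD. Qed.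
Lemma tensA_scaleDl v : {morph tensA_scale^~ v : a b / a + b}.
Proof.
move=> a b.
apply: (@tensA_eq M N _ (tensA_scale (a + b)) (tensA_scale a \+ tensA_scale b)).
- exact: tensA_scaleD.
- by move=> x y /=; rewrite !tensA_scaleD addrACA.
- by move=> m n /=; rewrite !tensA_scaleE ractDr; apply: tpureDr.
Qed.

HB.instance Definition _ := GRing.Zmodule_isLmodule.Build A^c (tensA M N)
  tensA_scaleA tensA_scale1 tensA_scaleDr tensA_scaleDl.

Lemma ract_tpure m n a :
  ract (tpure m n : tensA M N) a = tpure m (ract n a).
Proof. exact: tensA_scaleE. Qed.
End TensRight.

Section TensBi.
Variables (M N : bimodule).

Definition tensA_lact (a : A) : tensA M N -> tensA M N := tmap (lact a) id.

Lemma tensA_lact_balanced (a : A) : balanced (@ract M) (@lact N)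
  (fun m n => tpure (lact a m) n : tensA M N).
Proof.
by apply: (@tmap_balanced M M N N (lact a) id)
  => // [x y|n b]; rewrite ?lactDr ?lact_ract.
Qed.
#[local] Hint Resolve tensA_lact_balanced : core.

Lemma tensA_lactE a m n : tensA_lact a (tpure m n) = tpure (lact a m) n.
Proof. exact: (tliftE _ _ (tensA_lact_balanced a)). Qed.
Lemma tensA_lactDr a x y : tensA_lact a (x + y) = tensA_lact a x + tensA_lact a y.
Proof. exact: (tliftD _ _ (tensA_lact_balanced a)). Qed.
Lemma tensA_lactDl a b x : tensA_lact (a + b) x = tensA_lact a x + tensA_lact b x.
Proof.
apply: (@tensA_eq M N _ (tensA_lact (a + b)) (tensA_lact a \+ tensA_lact b)).
- exact: tensA_lactDr.
- by move=> u v /=; rewrite !tensA_lactDr addrACA.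
- by move=> m n /=; rewrite !tensA_lactE lactDl; apply: tpureDl.
Qed.
Lemma tensA_lactA a b x : tensA_lact a (tensA_lact b x) = tensA_lact (a * b) x.
Proof.
apply: (@tensA_eq M N _ (tensA_lact a \o tensA_lact b) (tensA_lact (a * b))).
- by move=> u v /=; rewrite !tensA_lactDr.
- exact: tensA_lactDr.
- by move=> m n /=; rewrite !tensA_lactE lactA.
Qed.
Lemma tensA_lact1 x : tensA_lact 1 x = x.
Proof.
apply: (@tensA_eq M N _ (tensA_lact 1) id) => [||m n] //.
- exact: tensA_lactDr.
- by rewrite tensA_lactE lact1.
Qed.
Lemma tensA_lact_ract a (x : tensA M N) b :
  tensA_lact a (ract x b) = ract (tensA_lact a x) b.
Proof.
apply: (@tensA_eq M N _ (fun x => tensA_lact a (ract x b))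
          (fun x => ract (tensA_lact a x) b)) => [u v|u v|m n].
- by rewrite ractDl tensA_lactDr.
- by rewrite tensA_lactDr ractDl.
- by rewrite tensA_lactE !ract_tpure tensA_lactE.
Qed.
Lemma tensA_central (k : K) x : tensA_lact k%:A x = ract x k%:A.
Proof.
apply: (@tensA_eq M N _ (tensA_lact k%:A) (fun x => ract x k%:A)) => [||m n].
- exact: tensA_lactDr.
- by move=> u v; rewrite ractDl.
- rewrite tensA_lactE ract_tpure lact_central -[ract n _]lact_central.
  exact: tpureA.
Qed.

Definition tensAA : bimodule :=
  @Bimodule (tensA M N) tensA_lact tensA_lactDr tensA_lactDl tensA_lactA
    tensA_lact1 tensA_lact_ract tensA_central.

Lemma lact_tpure a m n :
  lact a (tpure m n : tensAA) = (tpure (lact a m) n : tensA M N).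
Proof. exact: tensA_lactE. Qed.
End TensBi.

Section Assoc.
Variables (M : lmodType A^c) (N P : bimodule).

Definition tassoc : tensA (tensA M N) P -> tensA M (tensAA N P) :=
  tlift (fun t p => tlift (fun m n => tpure m (tpure n p : tensA N P)) t).

Lemma tassoc_balanced p : balanced (@ract M) (@lact N)
  (fun m n => tpure m (tpure n p : tensA N P) : tensA M (tensAA N P)).
Proof.
split=> [m m' n|m n n'|m a n].
- exact: tpureDl.
- by rewrite [in LHS]tpureDl; apply: tpureDr.
- by rewrite -lact_tpure; apply: tpureA.
Qed.
#[local] Hint Resolve tassoc_balanced : core.

Lemma tassoc_balanced2 : balanced (@ract (tensA M N)) (@lact P)
  (fun t p => tlift (fun m n => tpure m (tpure n p : tensA N P)) t
     : tensA M (tensAA N P)).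
Proof.
split=> [t t' p|t p p'|t a p].
- exact: tliftD.
- apply: (@tensA_eq M N _ (fun t => tlift (fun m n => tpure m (tpure n (p + p') : tensA N P)) t)
   (fun t => tlift (fun m n => tpure m (tpure n p : tensA N P)) t +
     tlift (fun m n => tpure m (tpure n p' : tensA N P)) t)) => [u v|u v|m n].
  + exact: tliftD.
  + by rewrite !tliftD //= addrACA.
  + by rewrite !tliftE //= [in LHS]tpureDr; apply: tpureDr.
- apply: (@tensA_eq M N _
   (fun t => tlift (fun m n => tpure m (tpure n p : tensA N P)) (ract t a))
   (fun t => tlift (fun m n => tpure m (tpure n (lact a p) : tensA N P)) t))
    => [u v|u v|m n].
  + by rewrite ractDl tliftD.
  + exact: tliftD.
  + by rewrite ract_tpure !tliftE //= [in LHS]tpureA.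
Qed.
#[local] Hint Resolve tassoc_balanced2 : core.

Lemma tassocD : {morph tassoc : x y / x + y}.
Proof. move=> x y; exact: tliftD. Qed.
Lemma tassocE m n p :
  tassoc (tpure (tpure m n : tensA M N) p) = tpure m (tpure n p : tensA N P).
Proof. by rewrite /tassoc tliftE // tliftE. Qed.
End Assoc.

End Bimodules.

Section Corings.
Variables (K : comPzRingType) (A : algType K).
Implicit Types M N : bimodule A.

Definition rlin (M N : lmodType A^c) (f : M -> N) :=
  {morph f : x y / x + y} /\ forall m a, f (ract m a) = ract (f m) a.
Definition llin (M N : bimodule A) (f : M -> N) :=
  {morph f : x y / x + y} /\ forall a m, f (lact a m) = lact a (f m).

Lemma rlin_linear (M N : lmodType A^c) (f : {linear M -> N}) : rlin f.
Proof. by split=> [x y|m a]; rewrite ?linearD ?ract_lin. Qed.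
#[local] Hint Resolve rlin_linear : core.
Lemma llin_bimod M N (f : bimodHom M N) : llin f.
Proof. by split=> [x y|m a]; rewrite ?linearD ?bimod_funL. Qed.
#[local] Hint Resolve llin_bimod : core.
Lemma rlin_id (M : lmodType A^c) : rlin (@id M). Proof. by []. Qed.
#[local] Hint Resolve rlin_id : core.
Lemma llin_id M : llin (@id M). Proof. by []. Qed.
#[local] Hint Resolve llin_id : core.

Lemma tmap_rlE (M M' : lmodType A^c) N N' (f : M -> M') (g : N -> N') m n :
  rlin f -> llin g -> tmap f g (tpure m n) = tpure (f m) (g n).
Proof. by case=> fD fA [gD gA]; apply: tmapE. Qed.

Lemma tmap_rlD (M M' : lmodType A^c) N N' (f : M -> M') (g : N -> N') :
  rlin f -> llin g -> {morph tmap f g : x y / x + y}.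
Proof. by case=> fD fA [gD gA]; apply: tmapD. Qed.

Lemma rlin_tmap (M M' : lmodType A^c) N N' (f : M -> M') (g : N -> N') :
  rlin f -> llin g -> rlin g -> rlin (tmap f g).
Proof.
move=> hf hg [_ gA]; split=> [|t a]; first exact: tmap_rlD.
apply: (@tensA_eq _ _ M N _ (fun t => tmap f g (ract t a))
          (fun t => ract (tmap f g t) a)) => [u v|u v|m n].
- by rewrite ractDl tmap_rlD.
- by rewrite tmap_rlD // ractDl.
- by rewrite ract_tpure !tmap_rlE // ract_tpure gA.
Qed.

Lemma llin_tmap M M' N N' (f : M -> M') (g : N -> N') :
  rlin f -> llin f -> llin g ->
  @llin (tensAA M N) (tensAA M' N') (tmap f g).
Proof.
move=> hf [_ fL] hg; split=> [|a t]; first exact: tmap_rlD.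
apply: (@tensA_eq _ _ M N _
    (fun t : tensAA M N => tmap f g (lact a t))
    (fun t => lact a (tmap f g t : tensAA M' N'))) => [u v|u v|m n].
- by rewrite lactDr tmap_rlD.
- by rewrite tmap_rlD // lactDr.
- by rewrite lact_tpure !tmap_rlE // lact_tpure fL.
Qed.

Lemma tmap_comp (M M' M'' : lmodType A^c) N N' N'' (f : M -> M') (g : N -> N')
  (f' : M' -> M'') (g' : N' -> N'') t :
  rlin f -> llin g -> rlin f' -> llin g' ->
  tmap f' g' (tmap f g t) = tmap (f' \o f) (g' \o g) t.
Proof.
move=> hf hg hf' hg'.
have hff : rlin (f' \o f).
  case: hf hf' => a b [c d]; split=> [x y|m r] /=; by rewrite ?a ?c ?b ?d.
have hgg : llin (g' \o g).
  case: hg hg' => a b [c d]; split=> [x y|m r] /=; by rewrite ?a ?c ?b ?d.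
apply: (@tensA_eq _ _ M N _ (tmap f' g' \o tmap f g)
          (tmap (f' \o f) (g' \o g))) => [u v|u v|m n] /=.
- by rewrite !tmap_rlD.
- by rewrite tmap_rlD.
- by rewrite !tmap_rlE.
Qed.

Lemma tassoc_nat (M M' : lmodType A^c) (N N' P P' : bimodule A) (f : M -> M') (g : N -> N')
  (h : P -> P') t : rlin f -> llin g -> rlin g -> llin h ->
  tassoc (tmap (tmap f g) h t) =
    tmap f (tmap g h : tensAA N P -> tensAA N' P') (tassoc t).
Proof.
move=> hf hg hg' hh.
have h1 : rlin (tmap f g) by apply: rlin_tmap.
have h2 : @llin (tensAA N P) (tensAA N' P') (tmap g h) by apply: llin_tmap.
apply: (@tensA_eq _ _ (tensA M N) P _ (fun t => tassoc (tmap (tmap f g) h t))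
   (fun t => tmap f (tmap g h : tensAA N P -> tensAA N' P') (tassoc t)))
   => [u v|u v|s p] /=.
- by rewrite tmap_rlD // tassocD.
- by rewrite tassocD tmap_rlD.
rewrite tmap_rlE //.
apply: (@tensA_eq _ _ M N _ (fun s => tassoc (tpure (tmap f g s) (h p)))
   (fun s => tmap f (tmap g h : tensAA N P -> tensAA N' P') (tassoc (tpure s p))))
   => [u v|u v|m n] /=.
- by rewrite tmap_rlD // tpureDl tassocD.
- by rewrite tpureDl tassocD tmap_rlD.
by rewrite !tmap_rlE // !tassocE tmap_rlE // [in RHS]tmap_rlE.
Qed.

(* In the structures below every tlift and tmap is applied to a balanced map,
   because its components are module maps. *)
Record coring := Coring {
  coring_car :> bimodule A;
  comul : bimodHom coring_car (tensAA coring_car coring_car);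
  counit : bimodHom coring_car (regbimod A);
  comulA : forall c : coring_car,
    tassoc (tmap comul id (comul c)) = tmap id comul (comul c);
  counitl : forall c : coring_car,
    tlift (fun x y => lact (counit x) y) (comul c) = c;
  counitr : forall c : coring_car,
    tlift (fun x y => ract x (counit y)) (comul c) = c
}.
Implicit Types C D E : coring.

Record coringHom C D := CoringHom {
  coring_fun :> bimodHom C D;
  coring_funM : forall c, comul D (coring_fun c) =
    tmap coring_fun coring_fun (comul C c);
  coring_fun1 : forall c, counit D (coring_fun c) = counit C c
}.

Record comodule D := Comodule {
  comod_car :> lmodType A^c;
  coact : {linear comod_car -> tensA comod_car D};
  coactA : forall m : comod_car,
    tassoc (tmap coact id (coact m)) = tmap id (comul D) (coact m);
  coact1 : forall m : comod_car,
    tlift (fun x d => ract x (counit D d)) (coact m) = m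
}.

Definition is_comod_map D (M N : comodule D) (f : {linear M -> N}) : Prop :=
  forall m, coact N (f m) = tmap f id (coact M m).

Definition comodHom D (M N : comodule D) := {f : {linear M -> N} | is_comod_map f}.

Record bicomodule D := Bicomodule {
  bicomod_car :> bimodule A;
  rcoact : bimodHom bicomod_car (tensAA bicomod_car D);
  lcoact : bimodHom bicomod_car (tensAA D bicomod_car);
  rcoactA : forall m : bicomod_car,
    tassoc (tmap rcoact id (rcoact m)) = tmap id (comul D) (rcoact m);
  rcoact1 : forall m : bicomod_car,
    tlift (fun x d => ract x (counit D d)) (rcoact m) = m;
  lcoactA : forall m : bicomod_car,
    tassoc (tmap (comul D) id (lcoact m)) = tmap id lcoact (lcoact m);
  lcoact1 : forall m : bicomod_car,
    tlift (fun d x => lact (counit D d) x) (lcoact m) = m;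
  lrcoact : forall m : bicomod_car,
    tassoc (tmap lcoact id (rcoact m)) = tmap id rcoact (lcoact m)
}.

Definition is_bicomod_map D (M N : bicomodule D) (f : bimodHom M N) : Prop :=
  (forall m, rcoact N (f m) = tmap f id (rcoact M m)) /\
  (forall m, lcoact N (f m) = tmap id f (lcoact M m)).

Definition regbicomod D : bicomodule D :=
  @Bicomodule D D (comul D) (comul D) (@comulA D) (@counitr D)
    (@comulA D) (@counitl D) (@comulA D).

(* Sub-bicomodules are given by injective bicomodule maps, since without
   flatness a sub-bimodule need not carry an induced structure. *)
Definition simple_coring D : Prop :=
  (exists d : D, d <> 0) /\
  forall (M : bicomodule D) (i : bimodHom M (regbicomod D)),
    is_bicomod_map i -> injective i ->
    (forall m, i m = 0) \/ (forall d, exists m, i m = d).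

(* The comodule over D induced from a comodule over C by a coring map C -> D. *)
Section Push.
Variables (C D : coring) (f : coringHom C D) (M : comodule C).

Definition push_coact (m : M) : tensA M D := tmap id f (coact M m).

Lemma rlin_push : rlin push_coact.
Proof.
have h : rlin (tmap (@id M) f) by apply: rlin_tmap.
case: h => hD hA; split=> [x y|m a]; rewrite /push_coact.
  by rewrite linearD hD.
by rewrite ract_lin hA.
Qed.

Lemma push_coact_linear : linear push_coact.
Proof.
case: rlin_push => hD hA a u v; rewrite hD; congr (_ + _).
exact: (hA u a).
Qed.
HB.instance Definition _ :=
  GRing.isLinear.Build A^c M (tensA M D) *:%R push_coact push_coact_linear.

Lemma push_coactA m :
  tassoc (tmap push_coact id (push_coact m)) = tmap id (comul D) (push_coact m).
Proof.
have hp := rlin_push.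
rewrite {2 3}/push_coact tmap_comp // tmap_comp //.
have -> : (push_coact \o id) = (tmap (@id M) f \o coact M) by [].
have -> : (comul D \o f) = ((tmap f f : tensAA C C -> tensAA D D) \o comul C).
  by apply: funext => c /=; rewrite coring_funM.
have hr : rlin (tmap (@id M) f) by apply: rlin_tmap.
have hl : @llin (tensAA C C) (tensAA D D) (tmap f f) by apply: llin_tmap.
have -> : tmap (tmap (@id M) f \o coact M) (@id D \o f) (coact M m) =
   tmap (tmap (@id M) f) f (tmap (coact M) id (coact M m)).
  rewrite tmap_comp //; exact: rlin_linear.
rewrite tassoc_nat // coactA tmap_comp //.
Qed.

Lemma push_coact1 m :
  tlift (fun x d => ract x (counit D d)) (push_coact m) = m.
Proof.
rewrite -[RHS](@coact1 C M m) /push_coact.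
have bal (E : coring) : balanced (@ract _ _ M) (@lact _ _ E)
    (fun x d => ract x (counit E d)).
  split=> [x y d|x d e|x a d]; rewrite ?ractDl ?linearD ?ractDr //.
  by rewrite bimod_funL ractA.
apply: (@tensA_eq _ _ M C _
   (fun t => tlift (fun x d => ract x (counit D d)) (tmap id f t))
   (tlift (fun x d => ract x (counit C d)))) => [u v|u v|x c].
- by rewrite tmap_rlD // tliftD.
- by rewrite tliftD.
- by rewrite tmap_rlE // !tliftE // coring_fun1.
Qed.

Definition push_comod : comodule D :=
  @Comodule D M push_coact push_coactA push_coact1.
End Push.

Definition coideal C (J : set C) : Prop :=
  exists (E : coring) (f : coringHom C E),
    (forall e, exists c, f c = e) /\ J = [set c | f c = 0]%classic.

Section Quotient.
Variables (C : coring) (J : set C) (hJ : coideal J).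

Lemma coideal_zmod : J 0 /\ (forall x y, J x -> J y -> J (x - y)).
Proof.
case: hJ => E [f [_ ->]]; split=> /= [|x y hx hy]; first by rewrite linear0.
by rewrite linearB hx hy subrr.
Qed.
Lemma coideal0 : J 0. Proof. exact: coideal_zmod.1. Qed.
Lemma coidealB x y : J x -> J y -> J (x - y). Proof. exact: coideal_zmod.2. Qed.
Lemma coidealN x : J x -> J (- x).
Proof. by move=> hx; rewrite -sub0r; apply: (coidealB coideal0 hx). Qed.
Lemma coidealD x y : J x -> J y -> J (x + y).
Proof. by move=> hx hy; rewrite -[y]opprK; apply/coidealB/coidealN. Qed.
Lemma coideal_ract x a : J x -> J (ract x a).
Proof. by case: hJ => E [f [_ ->]] /= hx; rewrite ract_lin hx /ract scaler0. Qed.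
Lemma coideal_lact x a : J x -> J (lact a x).
Proof.
case: hJ => E [f [_ ->]] /= hx; rewrite bimod_funL hx.
by apply: (addrI (lact a 0)); rewrite -lactDr !addr0.
Qed.

Definition qeq (x y : C) : bool := `[< J (x - y) >].
Lemma qeq_refl : reflexive qeq.
Proof. by move=> x; apply/asboolP; rewrite subrr; exact: coideal0. Qed.
Lemma qeq_sym : symmetric qeq.
Proof.
by move=> x y; apply/asboolP/asboolP => /coidealN; rewrite opprB.
Qed.
Lemma qeq_trans : transitive qeq.
Proof.
move=> y x z /asboolP h1 /asboolP h2; apply/asboolP.
by have := coidealD h1 h2; rewrite addrA subrK.
Qed.
Canonical qeq_equiv := EquivRel qeq qeq_refl qeq_sym qeq_trans.

Definition quot_car : Type := {eq_quot qeq_equiv}.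
HB.instance Definition _ := Choice.on quot_car.
Definition qpi (x : C) : quot_car := \pi_{eq_quot qeq_equiv} x.
Definition qrepr (q : quot_car) : C := repr (q : {eq_quot qeq_equiv}).
Lemma qreprK q : qpi (qrepr q) = q. Proof. exact: reprK. Qed.
Lemma qpiP x y : qpi x = qpi y <-> J (x - y).
Proof. by split=> [/eqmodP/asboolP|h] //; apply/eqmodP/asboolP. Qed.
Lemma qreprP x : J (qrepr (qpi x) - x).
Proof. by apply/qpiP; rewrite qreprK. Qed.
Lemma quot_ind (Q : quot_car -> Prop) : (forall x, Q (qpi x)) -> forall q, Q q.
Proof. by move=> h q; rewrite -[q]qreprK. Qed.

Definition qadd p q := qpi (qrepr p + qrepr q).
Definition qopp p := qpi (- qrepr p).
Definition qzero := qpi 0.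
Lemma qaddE x y : qadd (qpi x) (qpi y) = qpi (x + y).
Proof. by apply/qpiP; rewrite opprD addrACA; apply: coidealD; apply: qreprP. Qed.
Lemma qoppE x : qopp (qpi x) = qpi (- x).
Proof. by apply/qpiP; rewrite -opprD; apply/coidealN/qreprP. Qed.
Lemma qaddA : associative qadd.
Proof.
elim/quot_ind => x; elim/quot_ind => y; elim/quot_ind => z.
by rewrite !qaddE addrA.
Qed.
Lemma qaddC : commutative qadd.
Proof. by elim/quot_ind => x; elim/quot_ind => y; rewrite !qaddE addrC. Qed.
Lemma qadd0 : left_id qzero qadd.
Proof. by elim/quot_ind => x; rewrite qaddE add0r. Qed.
Lemma qaddN : left_inverse qzero qopp qadd.
Proof. by elim/quot_ind => x; rewrite qoppE qaddE addNr. Qed.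

HB.instance Definition _ := GRing.isZmodule.Build quot_car
  qaddA qaddC qadd0 qaddN.

Lemma qpiD : {morph qpi : x y / x + y}.
Proof. by move=> x y; rewrite -qaddE. Qed.

Definition qscale (a : A^c) (q : quot_car) : quot_car := qpi (ract (qrepr q) a).
Definition qlact (a : A) (q : quot_car) : quot_car := qpi (lact a (qrepr q)).
Lemma lactB (M : bimodule A) a (x y : M) : lact a (x - y) = lact a x - lact a y.
Proof. by apply/eqP; rewrite eq_sym subr_eq -lactDr subrK. Qed.
Lemma qscaleE a x : qscale a (qpi x) = qpi (ract x a).
Proof. by apply/qpiP; rewrite -[X in J X]scalerBr; apply/coideal_ract/qreprP. Qed.
Lemma qlactE a x : qlact a (qpi x) = qpi (lact a x).
Proof. by apply/qpiP; rewrite -lactB; apply/coideal_lact/qreprP. Qed.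

Lemma qscaleA a b v : qscale a (qscale b v) = qscale (a * b) v.
Proof. by elim/quot_ind: v => x; rewrite !qscaleE ractA. Qed.
Lemma qscale1 : left_id 1 qscale.
Proof. by elim/quot_ind => x; rewrite qscaleE ract1. Qed.
Lemma qscaleDr : right_distributive qscale +%R.
Proof.
move=> a; elim/quot_ind => x; elim/quot_ind => y.
by rewrite -qpiD !qscaleE -qpiD ractDl.
Qed.
Lemma qscaleDl v : {morph qscale^~ v : a b / a + b}.
Proof.
by elim/quot_ind: v => x a b; rewrite !qscaleE -qpiD ractDr.
Qed.
HB.instance Definition _ := GRing.Zmodule_isLmodule.Build A^c quot_car
  qscaleA qscale1 qscaleDr qscaleDl.

Lemma qpi_ract x a : qpi (ract x a) = ract (qpi x) a.
Proof. by rewrite -qscaleE. Qed.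

Lemma qlactDr a (p q : quot_car) : qlact a (p + q) = qlact a p + qlact a q.
Proof.
by elim/quot_ind: p => x; elim/quot_ind: q => y;
  rewrite -qpiD !qlactE -qpiD lactDr.
Qed.
Lemma qlactDl a b (q : quot_car) : qlact (a + b) q = qlact a q + qlact b q.
Proof. by elim/quot_ind: q => x; rewrite !qlactE -qpiD lactDl. Qed.
Lemma qlactA a b q : qlact a (qlact b q) = qlact (a * b) q.
Proof. by elim/quot_ind: q => x; rewrite !qlactE lactA. Qed.
Lemma qlact1 q : qlact 1 q = q.
Proof. by elim/quot_ind: q => x; rewrite !qlactE lact1. Qed.
Lemma qlact_ract a (q : quot_car) b : qlact a (ract q b) = ract (qlact a q) b.
Proof.
by elim/quot_ind: q => x; rewrite -qpi_ract !qlactE -qpi_ract lact_ract.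
Qed.
Lemma qcentral (k : K) (q : quot_car) : qlact k%:A q = ract q k%:A.
Proof. by elim/quot_ind: q => x; rewrite qlactE -qpi_ract lact_central. Qed.

Definition quot_bimod : bimodule A :=
  @Bimodule K A quot_car qlact qlactDr qlactDl qlactA qlact1 qlact_ract qcentral.

Lemma qpi_lact x a : qpi (lact a x) = @lact _ _ quot_bimod a (qpi x).
Proof. by rewrite -qlactE. Qed.

Lemma qpi_linear : linear (qpi : C -> quot_bimod).
Proof. by move=> a x y; rewrite qpiD; congr (_ + _); apply: (qpi_ract x a). Qed.
HB.instance Definition _ :=
  GRing.isLinear.Build A^c C quot_bimod *:%R qpi qpi_linear.

Definition quot_pi : bimodHom C quot_bimod :=
  @BimodHom K A C quot_bimod qpi (fun a x => qpi_lact x a).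

Definition quot_tens_pi : tensAA C C -> tensAA quot_bimod quot_bimod := tmap quot_pi quot_pi.
Lemma quot_tens_pi_rlin : rlin quot_tens_pi. Proof. exact: rlin_tmap. Qed.
Lemma quot_tens_pi_llin : llin quot_tens_pi. Proof. exact: llin_tmap. Qed.

Lemma comul_J c : J c -> quot_tens_pi (comul C c) = 0.
Proof.
case: hJ => E [f [fsurj Jf]] hc.
have fc : f c = 0 by move: hc; rewrite Jf.
have [s sK] := choice fsurj.
have pis x : qpi (s (f x)) = qpi x.
  by apply/qpiP; rewrite Jf /= linearB sK subrr.
pose g (e : E) : quot_bimod := qpi (s e).
have gE x : g (f x) = qpi x by apply: pis.
have rg : rlin g.
  split=> [x y|x a].
    case: (fsurj x) => u <-; case: (fsurj y) => v <-.
    by rewrite -linearD !gE qpiD.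
  by case: (fsurj x) => u <-; rewrite -ract_lin !gE qpi_ract.
have lg : llin g.
  split=> [|a x]; first by case: rg.
  by case: (fsurj x) => u <-; rewrite -bimod_funL !gE qpi_lact.
have -> : quot_tens_pi (comul C c) = tmap g g (tmap f f (comul C c)).
  rewrite tmap_comp //; congr (tmap _ _ _); apply: funext => x /=;
  by rewrite ?gE.
rewrite -coring_funM fc linear0.
by apply: (addrI (tmap g g 0)); rewrite -tmap_rlD ?addr0.
Qed.

Lemma counit_J c : J c -> counit C c = 0.
Proof.
by case: hJ => E [f [_ ->]] /= hc; rewrite -(coring_fun1 f) hc linear0.
Qed.

Definition qcomul (q : quot_bimod) : tensAA quot_bimod quot_bimod :=
  quot_tens_pi (comul C (qrepr q)).
Lemma qcomulE x : qcomul (qpi x) = quot_tens_pi (comul C x).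
Proof.
case: quot_tens_pi_rlin => D _; rewrite /qcomul -[qrepr _](subrK x).
by rewrite linearD D comul_J ?add0r //; apply: qreprP.
Qed.
Lemma qcomul_linear : linear qcomul.
Proof.
move=> a; elim/quot_ind => x; elim/quot_ind => y.
rewrite -(linearP (qpi : {linear C -> quot_bimod})) !qcomulE linearP.
by case: quot_tens_pi_rlin => -> rA; congr (_ + _); apply: rA.
Qed.
HB.instance Definition _ := GRing.isLinear.Build A^c quot_bimod
  (tensAA quot_bimod quot_bimod) *:%R qcomul qcomul_linear.
Lemma qcomulL a (q : quot_bimod) : qcomul (lact a q) = lact a (qcomul q).
Proof.
elim/quot_ind: q => x; rewrite -qpi_lact !qcomulE bimod_funL.
by case: quot_tens_pi_llin.
Qed.
Definition quot_comul : bimodHom quot_bimod (tensAA quot_bimod quot_bimod) :=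
  @BimodHom K A quot_bimod (tensAA quot_bimod quot_bimod) qcomul qcomulL.

Definition qcounit (q : quot_bimod) : regbimod A := counit C (qrepr q).
Lemma qcounitE x : qcounit (qpi x) = counit C x.
Proof.
rewrite /qcounit -[qrepr _](subrK x) linearD counit_J ?add0r //.
exact: qreprP.
Qed.
Lemma qcounit_linear : linear qcounit.
Proof.
move=> a; elim/quot_ind => x; elim/quot_ind => y.
by rewrite -(linearP (qpi : {linear C -> quot_bimod})) !qcounitE linearP.
Qed.
HB.instance Definition _ := GRing.isLinear.Build A^c quot_bimod (regbimod A)
  *:%R qcounit qcounit_linear.
Lemma qcounitL a (q : quot_bimod) : qcounit (lact a q) = lact a (qcounit q).
Proof.
by elim/quot_ind: q => x; rewrite -qpi_lact !qcounitE bimod_funL.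
Qed.
Definition quot_counit : bimodHom quot_bimod (regbimod A) :=
  @BimodHom K A quot_bimod (regbimod A) qcounit qcounitL.

Lemma quot_comulE x : quot_comul (quot_pi x) = tmap quot_pi quot_pi (comul C x).
Proof. exact: qcomulE. Qed.
Lemma quot_counitE x : quot_counit (quot_pi x) = counit C x.
Proof. exact: qcounitE. Qed.

Lemma quot_comulA c :
  tassoc (tmap quot_comul id (quot_comul c)) =
    tmap id quot_comul (quot_comul c).
Proof.
elim/quot_ind: c => x; rewrite quot_comulE !tmap_comp //.
have e1 : quot_comul \o quot_pi = quot_tens_pi \o comul C.
  by apply: funext => y /=; rewrite quot_comulE.
rewrite e1.
have -> : tmap (quot_tens_pi \o comul C) (@id quot_bimod \o quot_pi) (comul C x) =
  tmap quot_tens_pi quot_pi (tmap (comul C) id (comul C x)).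
  by rewrite tmap_comp //; exact: quot_tens_pi_rlin.
have -> : tmap (@id quot_bimod \o quot_pi) (quot_tens_pi \o comul C) (comul C x) =
  tmap quot_pi quot_tens_pi (tmap id (comul C) (comul C x)).
  by rewrite tmap_comp //; exact: quot_tens_pi_llin.
by rewrite /quot_tens_pi tassoc_nat // comulA.
Qed.

Lemma quot_counitl c :
  tlift (fun x y => lact (quot_counit x) y) (quot_comul c) = c.
Proof.
elim/quot_ind: c => x; rewrite quot_comulE -[RHS]/(quot_pi x).
rewrite -[in RHS](@counitl C x).
have bal (M : bimodule A) (u : bimodHom M (regbimod A)) :
   balanced (@ract _ _ M) (@lact _ _ M) (fun x y => lact (u x) y : M).
  split=> [y z d|y d e|y a d]; rewrite ?lactDr ?linearD ?lactDl //.
  by rewrite ract_lin lactA.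
apply: (@tensA_eq _ _ C C _
   (fun t => tlift (fun x y => lact (quot_counit x) y) (tmap quot_pi quot_pi t))
   (fun t => quot_pi (tlift (fun x y => lact (counit C x) y) t)))
   => [u v|u v|y z].
- by rewrite tmap_rlD // tliftD.
- by rewrite tliftD // linearD.
- by rewrite tmap_rlE // !tliftE // quot_counitE bimod_funL.
Qed.

Lemma quot_counitr c :
  tlift (fun x y => ract x (quot_counit y)) (quot_comul c) = c.
Proof.
elim/quot_ind: c => x; rewrite quot_comulE -[RHS]/(quot_pi x).
rewrite -[in RHS](@counitr C x).
have bal (M : bimodule A) (u : bimodHom M (regbimod A)) :
   balanced (@ract _ _ M) (@lact _ _ M) (fun x y => ract x (u y) : M).
  split=> [y z d|y d e|y a d]; rewrite ?ractDl ?linearD ?ractDr //.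
  by rewrite bimod_funL ractA.
apply: (@tensA_eq _ _ C C _
   (fun t => tlift (fun x y => ract x (quot_counit y)) (tmap quot_pi quot_pi t))
   (fun t => quot_pi (tlift (fun x y => ract x (counit C y)) t)))
   => [u v|u v|y z].
- by rewrite tmap_rlD // tliftD.
- by rewrite tliftD // linearD.
- by rewrite tmap_rlE // !tliftE // quot_counitE ract_lin.
Qed.

Definition quot_coring : coring :=
  @Coring quot_bimod quot_comul quot_counit quot_comulA quot_counitl quot_counitr.

Definition quot_proj : coringHom C quot_coring :=
  @CoringHom C quot_coring quot_pi quot_comulE quot_counitE.

End Quotient.

End Corings.

Section Categories.

Record category := Category {
  obj :> Type;
  mor : obj -> obj -> Type;
  idm : forall X, mor X X;
  mor_comp : forall X Y Z, mor Y Z -> mor X Y -> mor X Z;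
  mor_compA : forall X Y Z T (h : mor Z T) (g : mor Y Z) (f : mor X Y),
    mor_comp h (mor_comp g f) = mor_comp (mor_comp h g) f;
  mor_comp1m : forall X Y (f : mor X Y), mor_comp (idm Y) f = f;
  mor_compm1 : forall X Y (f : mor X Y), mor_comp f (idm X) = f
}.

Variable Cat : category.
Implicit Types X Y Z W : Cat.
Local Notation "g 'oo' f" := (@mor_comp Cat _ _ _ g f) (at level 50).

Definition zero_obj Z : Prop :=
  (forall X, exists! f : mor Z X, True) /\ (forall X, exists! f : mor X Z, True).

Definition zero_mor X Y (f : mor X Y) : Prop :=
  exists Z (g : mor Z Y) (h : mor X Z), zero_obj Z /\ f = g oo h.

Definition is_mono X Y (f : mor X Y) : Prop :=
  forall W (g h : mor W X), f oo g = f oo h -> g = h.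

Definition is_epi X Y (f : mor X Y) : Prop :=
  forall W (g h : mor Y W), g oo f = h oo f -> g = h.

Definition is_iso X Y (f : mor X Y) : Prop :=
  exists g : mor Y X, g oo f = idm X /\ f oo g = idm Y.

Definition is_kernel W X Y (k : mor W X) (f : mor X Y) : Prop :=
  zero_mor (f oo k) /\
  forall V (g : mor V X), zero_mor (f oo g) -> exists! h : mor V W, k oo h = g.

Definition is_cokernel X Y W (f : mor X Y) (q : mor Y W) : Prop :=
  zero_mor (q oo f) /\
  forall V (g : mor Y V), zero_mor (g oo f) -> exists! h : mor W V, h oo q = g.

Definition is_product X Y P (p : mor P X) (q : mor P Y) : Prop :=
  forall W (f : mor W X) (g : mor W Y),
    exists! h : mor W P, p oo h = f /\ q oo h = g.

Definition is_coproduct (I : Type) (F : I -> Cat) S (i : forall j, mor (F j) S) :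
    Prop :=
  forall W (f : forall j, mor (F j) W),
    exists! h : mor S W, forall j, h oo i j = f j.

Definition abelian_category : Prop :=
  [/\ exists Z, zero_obj Z,
      forall X Y, exists P (p : mor P X) (q : mor P Y), is_product p q,
      forall X Y, exists S (i : forall b : bool, mor (if b then X else Y) S),
        is_coproduct i,
      (forall X Y (f : mor X Y), exists W (k : mor W X), is_kernel k f) /\
      (forall X Y (f : mor X Y), exists W (q : mor Y W), is_cokernel f q)
    & (forall X Y (f : mor X Y), is_mono f -> exists Z (g : mor Y Z), is_kernel f g) /\
      (forall X Y (f : mor X Y), is_epi f -> exists Z (g : mor Z X), is_cokernel g f)].

Definition simple_obj X : Prop :=
  ~ zero_obj X /\ forall Y (f : mor Y X), is_mono f -> zero_mor f \/ is_iso f.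

Definition semisimple_obj X : Prop :=
  exists (I : Type) (F : I -> Cat) (i : forall j, mor (F j) X),
    (forall j, simple_obj (F j)) /\ is_coproduct i.

End Categories.

Section Cosemisimple.
Variables (K : comPzRingType) (A : algType K) (D : coring A).

Lemma comodHom_ext (M N : comodule D) (f g : comodHom M N) :
  sval f =1 sval g -> f = g.
Proof.
case: f g => [f hf] [g hg] /= /linear_ext efg.
by case: _ / efg in hg *; rewrite (Prop_irrelevance hf hg).
Qed.

Lemma comod_id_subproof (M : comodule D) :
  is_comod_map (idfun : {linear M -> M}).
Proof.
move=> m /=; apply: (@tensA_eq _ _ M D _ id (tmap idfun id)) => //.
- exact: (tmap_rlD (rlin_id _) (llin_id _)).
- by move=> x y; rewrite (tmap_rlE _ _ (rlin_id _) (llin_id _)).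
Qed.

Definition comod_id (M : comodule D) : comodHom M M :=
  exist _ _ (@comod_id_subproof M).

Lemma comod_comp_subproof (M N P : comodule D) (g : comodHom N P)
  (f : comodHom M N) : is_comod_map (sval g \o sval f : {linear M -> P}).
Proof.
case: f g => [f hf] [g hg] m /=; rewrite hg hf.
by rewrite (tmap_comp _ (rlin_linear f) (llin_id _) (rlin_linear g) (llin_id _)).
Qed.

Definition comod_comp (M N P : comodule D) (g : comodHom N P)
  (f : comodHom M N) : comodHom M P := exist _ _ (@comod_comp_subproof M N P g f).

Definition comod_category : category.
Proof.
refine (@Category (comodule D) (@comodHom _ _ D) comod_id comod_comp _ _ _).
- by move=> X Y Z T h g f; apply: comodHom_ext.
- by move=> X Y f; apply: comodHom_ext.
- by move=> X Y f; apply: comodHom_ext.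
Defined.

Definition cosemisimple : Prop :=
  abelian_category comod_category /\
  forall M : comod_category, semisimple_obj M.

Definition simple_cosemisimple : Prop := simple_coring D /\ cosemisimple.

End Cosemisimple.

Section Modules.
Variables (R : pzRingType) (M : lmodType R).

Definition finitely_generated : Prop :=
  exists (n : nat) (e : 'I_n -> M),
    forall x, exists c : 'I_n -> R, x = \sum_i c i *: e i.

Definition projective : Prop :=
  forall (P Q : lmodType R) (g : {linear P -> Q}) (f : {linear M -> Q}),
    (forall q, exists p, g p = q) ->
    exists h : {linear M -> P}, forall x, g (h x) = f x.

Definition simple_module : Prop :=
  (exists x : M, x <> 0) /\
  forall N : set M, submod_closed [in N] ->
    N = [set 0]%classic \/ N = [set: M]%classic.

Record dual_basis := DualBasis {
  db_size : nat;
  db_vec : 'I_db_size -> M;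
  db_form : 'I_db_size -> {linear M -> R^o};
  db_eq : forall x, x = \sum_i (db_form i x : R) *: db_vec i
}.

Arguments db_vec : clear implicits.
Arguments db_form : clear implicits.

Lemma dual_basis_exists : finitely_generated -> projective ->
  exists d : dual_basis, True.
Proof.
case=> n [e he] hp.
pose g (c : 'rV[R]_n) : M := \sum_i c 0 i *: e i.
have g_lin : linear g.
  move=> a u v; rewrite /g scaler_sumr -big_split /=; apply: eq_bigr => i _.
  by rewrite !mxE scalerDl scalerA.
pose gL := GRing.isLinear.Build R 'rV[R]_n M *:%R g g_lin.
pose G : {linear 'rV[R]_n -> M} := HB.pack g gL.
have [|h hK] := hp 'rV[R]_n M G (idfun : {linear M -> M}).
  move=> x; have [c ->] := he x; exists (\row_i c i).
  by apply: eq_bigr => i _; rewrite mxE.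
pose p i (x : M) : R^o := h x 0 i.
have p_lin i : linear (p i).
  by move=> a u v; rewrite /p linearP !mxE.
pose pL i := GRing.isLinear.Build R M R^o *:%R (p i) (p_lin i).
pose F i : {linear M -> R^o} := HB.pack (p i) (pL i).
by exists (@DualBasis n e F (fun x => esym (hK x))).
Qed.

Definition dual_basis_of (hfg : finitely_generated) (hp : projective) :
  dual_basis := sval (cid (dual_basis_exists hfg hp)).

End Modules.
Arguments db_vec {R M}.
Arguments db_form {R M}.


Section Comatrix.
Variables (K : comPzRingType) (A : algType K) (Sigma : lmodType A^c).
Local Notation End := {linear Sigma -> Sigma}.
Local Notation dual := {linear Sigma -> (A^c)^o}.

(* Multiplication by a scalar of K, acting through the right A-action. *)
Definition kscale (k : K) (x : Sigma) : Sigma := ract x k%:A.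
Lemma kscale_linear k : linear (kscale k).
Proof.
move=> a u v; rewrite /kscale ractDl; congr (_ + _).
by rewrite -!/(ract _ a) !ractA mulr_algr mulr_algl.
Qed.
HB.instance Definition _ k :=
  GRing.isLinear.Build A^c Sigma Sigma *:%R (kscale k) (kscale_linear k).

(* Since all rings are K-algebras, a subring contains the image of K. *)
Definition is_subring (B : set End) : Prop :=
  subring_closed [in B] /\ forall k : K, B (kscale k).

Definition is_division_subring (B : set End) : Prop :=
  [/\ is_subring B, (1 : End) != 0 &
      forall f, B f -> f != 0 -> exists g, [/\ B g, f * g = 1 & g * f = 1]].

Definition intermediate_division_subring (B C : set End) : Prop :=
  (B `<=` C)%classic /\ is_division_subring C.

(* The abelian group Sigma^* (x)_B Sigma. *)
Definition dual_end (B : set End) (phi : dual) (b : {b : End | B b}) : dual :=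
  phi \o sval b.
Definition end_act (B : set End) (b : {b : End | B b}) (x : Sigma) : Sigma :=
  sval b x.
Definition cmx (B : set End) : Type := tens (@dual_end B) (@end_act B).
HB.instance Definition _ B := GRing.Zmodule.on (cmx B).

(* The kernel of the canonical map
   Sigma^* (x)_B Sigma -> Sigma^* (x)_C Sigma, for B contained in C. *)
Definition cmx_proj (B C : set End) : cmx B -> cmx C :=
  tlift (fun phi x => tpure phi x).
Definition cmx_ker (B C : set End) : set (cmx B) :=
  [set t | cmx_proj C t = 0]%classic.

Lemma cmx_projE (B C : set End) phi x : (B `<=` C)%classic ->
  cmx_proj C (tpure phi x : cmx B) = tpure phi x.
Proof.
move=> BC; apply: tliftE; split=> [*|*|m r n]; rewrite ?tpureDl ?tpureDr //.
exact: (@tpureA _ _ _ (@dual_end C) (@end_act C) m (exist C (sval r) (BC _ (svalP r))) n).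
Qed.

Lemma cmxA (B : set End) phi b x :
  (tpure (@dual_end B phi b) x : cmx B) = tpure phi (end_act b x).
Proof. exact: tpureA. Qed.

Lemma cmx_eq (B : set End) (P : zmodType) (f g : cmx B -> P) :
  {morph f : x y / x + y} -> {morph g : x y / x + y} ->
  (forall phi x, f (tpure phi x) = g (tpure phi x)) -> f =1 g.
Proof. exact: tens_fun_eq. Qed.

Definition dual_lact_fun (a : A) (phi : dual) (x : Sigma) : (A^c)^o :=
  a * (phi x : A).
Lemma dual_lact_linear a phi : linear (dual_lact_fun a phi).
Proof.
move=> b u v; rewrite /dual_lact_fun linearP.
by rewrite [LHS](@mulrDr A) [X in X + _]mulrA.
Qed.
HB.instance Definition _ a phi := GRing.isLinear.Build A^c Sigma (A^c)^o *:%R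
  (dual_lact_fun a phi) (dual_lact_linear a phi).
Definition dual_lact a phi : dual := dual_lact_fun a phi.

Section Bimod.
Variable B : set End.

Definition cmx_scale (a : A^c) : cmx B -> cmx B :=
  tlift (fun phi x => tpure phi (ract x a)).
Definition cmx_lact (a : A) : cmx B -> cmx B :=
  tlift (fun phi x => tpure (dual_lact a phi) x).

Lemma cmx_scale_balanced (a : A^c) : balanced (@dual_end B) (@end_act B)
  (fun phi x => tpure phi (ract x a) : cmx B).
Proof.
split=> [u v x|u x y|u b x].
- exact: tpureDl.
- by rewrite ractDl; apply: tpureDr.
- by rewrite cmxA /end_act ract_lin.
Qed.
Lemma cmx_lact_balanced (a : A) : balanced (@dual_end B) (@end_act B)
  (fun phi x => tpure (dual_lact a phi) x : cmx B).
Proof.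
split=> [u v x|u x y|u b x].
- rewrite -[RHS]tpureDl; congr (tpure _ _); apply: linear_ext => z.
  exact: (@mulrDr A).
- exact: tpureDr.
- rewrite -[RHS]cmxA; congr (tpure _ _).
  exact: linear_ext.
Qed.
#[local] Hint Resolve cmx_scale_balanced cmx_lact_balanced : core.

Lemma cmx_scaleE a phi x : cmx_scale a (tpure phi x) = tpure phi (ract x a).
Proof. exact: tliftE. Qed.
Lemma cmx_scaleDr : right_distributive cmx_scale +%R.
Proof. by move=> a x y; apply: tliftD. Qed.
Lemma cmx_scaleA a b v : cmx_scale a (cmx_scale b v) = cmx_scale (a * b) v.
Proof.
apply: (@cmx_eq B _ (cmx_scale a \o cmx_scale b) (cmx_scale (a * b))).
- by move=> x y /=; rewrite !cmx_scaleDr.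
- exact: cmx_scaleDr.
- by move=> phi x /=; rewrite !cmx_scaleE ractA.
Qed.
Lemma cmx_scale1 : left_id 1 cmx_scale.
Proof.
apply: (@cmx_eq B _ (cmx_scale 1) id) => [||phi x] //.
- exact: cmx_scaleDr.
- by rewrite cmx_scaleE ract1.
Qed.
Lemma cmx_scaleDl v : {morph cmx_scale^~ v : a b / a + b}.
Proof.
move=> a b.
apply: (@cmx_eq B _ (cmx_scale (a + b)) (cmx_scale a \+ cmx_scale b)).
- exact: cmx_scaleDr.
- by move=> x y /=; rewrite !cmx_scaleDr addrACA.
- by move=> phi x /=; rewrite !cmx_scaleE ractDr; apply: tpureDr.
Qed.
HB.instance Definition _ := GRing.Zmodule_isLmodule.Build A^c (cmx B)
  cmx_scaleA cmx_scale1 cmx_scaleDr cmx_scaleDl.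

Lemma cmx_ract a phi x : ract (tpure phi x : cmx B) a = tpure phi (ract x a).
Proof. exact: cmx_scaleE. Qed.

Lemma cmx_lactE a phi x : cmx_lact a (tpure phi x) = tpure (dual_lact a phi) x.
Proof. exact: tliftE. Qed.
Lemma cmx_lactDr a x y : cmx_lact a (x + y) = cmx_lact a x + cmx_lact a y.
Proof. exact: tliftD. Qed.
Lemma cmx_lactDl a b v : cmx_lact (a + b) v = cmx_lact a v + cmx_lact b v.
Proof.
apply: (@cmx_eq B _ (cmx_lact (a + b)) (cmx_lact a \+ cmx_lact b)).
- exact: cmx_lactDr.
- by move=> x y /=; rewrite !cmx_lactDr addrACA.
- move=> phi x /=; rewrite !cmx_lactE -[RHS]tpureDl; congr (tpure _ _).
  by apply: linear_ext => z; apply: (@mulrDl A).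
Qed.
Lemma cmx_lactA a b v : cmx_lact a (cmx_lact b v) = cmx_lact (a * b) v.
Proof.
apply: (@cmx_eq B _ (cmx_lact a \o cmx_lact b) (cmx_lact (a * b))).
- by move=> x y /=; rewrite !cmx_lactDr.
- exact: cmx_lactDr.
- move=> phi x /=; rewrite !cmx_lactE; congr (tpure _ _).
  by apply: linear_ext => z; apply: (@mulrA A).
Qed.
Lemma cmx_lact1 v : cmx_lact 1 v = v.
Proof.
apply: (@cmx_eq B _ (cmx_lact 1) id) => [||phi x] //.
- exact: cmx_lactDr.
- rewrite cmx_lactE; congr (tpure _ _).
  by apply: linear_ext => z; apply: (@mul1r A).
Qed.
Lemma cmx_lact_ract a (v : cmx B) b : cmx_lact a (ract v b) = ract (cmx_lact a v) b.
Proof.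
apply: (@cmx_eq B _ (fun v => cmx_lact a (ract v b))
          (fun v => ract (cmx_lact a v) b)) => [x y|x y|phi x].
- by rewrite ractDl cmx_lactDr.
- by rewrite cmx_lactDr ractDl.
- by rewrite cmx_lactE !cmx_ract cmx_lactE.
Qed.

Hypothesis hB : is_subring B.

Lemma cmx_central (k : K) v : cmx_lact k%:A v = ract v k%:A.
Proof.
apply: (@cmx_eq B _ (cmx_lact k%:A) (fun v => ract v k%:A)) => [||phi x].
- exact: cmx_lactDr.
- by move=> x y; rewrite ractDl.
- rewrite cmx_lactE cmx_ract.
  rewrite -[RHS](cmxA phi (exist B _ (hB.2 k)) x); congr (tpure _ _).
  apply: linear_ext => z /=; rewrite /kscale ract_lin.
  by rewrite [LHS]mulr_algl [RHS]mulr_algr.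
Qed.

Definition cmx_bimod : bimodule A :=
  @Bimodule K A (cmx B) cmx_lact cmx_lactDr cmx_lactDl cmx_lactA
    cmx_lact1 cmx_lact_ract cmx_central.

Lemma cmx_bimod_lact a phi x :
  lact a (tpure phi x : cmx_bimod) = (tpure (dual_lact a phi) x : cmx B).
Proof. exact: cmx_lactE. Qed.

End Bimod.

Section Coring.
Variables (d : dual_basis Sigma) (B : set End) (hB : is_subring B).
Local Notation e := (db_vec d).
Local Notation e' := (db_form d).
Local Notation CB := (cmx_bimod hB).

Lemma db_ract x : x = \sum_i ract (e i) (e' i x).
Proof. exact: db_eq. Qed.

Lemma db_dual (phi : dual) : phi = \sum_i dual_lact (phi (e i)) (e' i).
Proof.
apply: linear_ext => x; rewrite {1}[x]db_ract linear_sum.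
have -> : (\sum_i dual_lact (phi (e i)) (e' i)) x =
          \sum_i (dual_lact (phi (e i)) (e' i)) x.
  by apply: (big_morph (fun f : dual => f x)).
by apply: eq_bigr => i _; rewrite ract_lin.
Qed.

Section SumLemmas.
Variables (M : lmodType A^c) (N : bimodule A).
Lemma tpureA_suml I (r : seq I) (F : I -> M) (n : N) :
  (tpure (\sum_(i <- r) F i) n : tensA M N) = \sum_(i <- r) tpure (F i) n.
Proof.
apply: (big_morph (fun m => tpure m n : tensA M N)) => [x y|].
  exact: tpureDl.
by apply: (addrI (tpure 0 n : tensA M N)); rewrite -[LHS]tpureDl !addr0.
Qed.
Lemma tpureA_sumr I (r : seq I) (F : I -> N) (m : M) :
  (tpure m (\sum_(i <- r) F i) : tensA M N) = \sum_(i <- r) tpure m (F i).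
Proof.
apply: (big_morph (fun n => tpure m n : tensA M N)) => [x y|].
  exact: tpureDr.
by apply: (addrI (tpure m 0 : tensA M N)); rewrite -[LHS]tpureDr !addr0.
Qed.
Lemma additive_sum (P : zmodType) (f : tensA M N -> P) I (r : seq I)
  (F : I -> tensA M N) : {morph f : x y / x + y} ->
  f (\sum_(i <- r) F i) = \sum_(i <- r) f (F i).
Proof.
move=> fD; apply: (big_morph f) => //.
by apply: (addrI (f 0)); rewrite -fD !addr0.
Qed.
End SumLemmas.

Lemma db_move (M : lmodType A^c) (N : bimodule A) (d1 : dual_basis Sigma)
    (u : Sigma -> M) (w : dual -> N) (f : End) :
  rlin u -> {morph w : x y / x + y} ->
  (forall a phi, w (dual_lact a phi) = lact a (w phi)) ->
  \sum_i (tpure (u (f (db_vec d1 i))) (w (db_form d1 i)) : tensA M N) =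
  \sum_i tpure (u (e i)) (w (e' i \o f)).
Proof.
case=> uD uA wD wA.
have w0 : w 0 = 0 by apply: (addrI (w 0)); rewrite -wD !addr0.
have u0 : u 0 = 0 by apply: (addrI (u 0)); rewrite -uD !addr0.
transitivity (\sum_i \sum_j (tpure (u (e j))
   (w (dual_lact (e' j (f (db_vec d1 i))) (db_form d1 i))) : tensA M N)).
  apply: eq_bigr => i _; rewrite {1}[f _]db_ract (big_morph u uD u0) tpureA_suml.
  by apply: eq_bigr => j _; rewrite uA wA; apply: tpureA.
rewrite exchange_big /=; apply: eq_bigr => j _.
rewrite -tpureA_sumr -(big_morph w wD w0); congr (tpure _ (w _)).
apply: linear_ext => x.
rewrite (big_morph (fun g : dual => g x) (id1 := 0) (op1 := +%R)) //=.
rewrite [in RHS](db_eq d1 x) !linear_sum; apply: eq_bigr => i _.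
by rewrite !linearZ.
Qed.

Definition cmx_comul_fun : CB -> tensAA CB CB :=
  tlift (fun phi x => \sum_i tpure (tpure phi (e i) : cmx B) (tpure (e' i) x : cmx B)).

Lemma rlin_tpure phi : rlin (tpure phi : Sigma -> cmx B).
Proof. by split=> [x y|x a]; rewrite ?cmx_ract //; apply: tpureDr. Qed.

Lemma cmx_comul_balanced : balanced (@dual_end B) (@end_act B)
  (fun phi x => \sum_i tpure (tpure phi (e i) : cmx B) (tpure (e' i) x : cmx B)
     : tensAA CB CB).
Proof.
split=> [u v x|u x y|u b x].
- rewrite -big_split; apply: eq_bigr => i _ /=.
  by rewrite -[RHS]tpureDl; congr (tpure _ _); apply: tpureDl.
- rewrite -big_split; apply: eq_bigr => i _ /=.
  by rewrite -[RHS]tpureDr; congr (tpure _ _); apply: tpureDr.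
- have := @db_move (cmx B) CB d (tpure u) (fun phi => tpure phi x : cmx B) (sval b)
    (rlin_tpure u) (fun p q => tpureDl _ _ _ _ _)
    (fun a phi => esym (cmx_bimod_lact hB a phi x)).
  move=> h; transitivity (\sum_i (tpure (tpure u (sval b (e i)) : cmx B)
     (tpure (e' i) x : cmx B) : tensA CB CB)).
    by apply: eq_bigr => i _; congr (tpure _ _); apply: cmxA.
  rewrite [LHS]h; apply: eq_bigr => i _; congr (tpure _ _).
  exact: cmxA.
Qed.
#[local] Hint Resolve cmx_comul_balanced : core.

Lemma cmx_comul_funE phi x : cmx_comul_fun (tpure phi x : cmx B) =
  \sum_i tpure (tpure phi (e i) : cmx B) (tpure (e' i) x : cmx B).
Proof. exact: tliftE. Qed.
Lemma cmx_comul_funD : {morph cmx_comul_fun : x y / x + y}.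
Proof. by move=> x y; apply: tliftD. Qed.

Lemma ract_sum (M : lmodType A^c) I (r : seq I) (F : I -> M) a :
  ract (\sum_(i <- r) F i) a = \sum_(i <- r) ract (F i) a.
Proof. exact: scaler_sumr. Qed.
Lemma lact_sum (M : bimodule A) I (r : seq I) (F : I -> M) a :
  lact a (\sum_(i <- r) F i) = \sum_(i <- r) lact a (F i).
Proof.
apply: (big_morph (lact a)) => [x y|]; first exact: lactDr.
by apply: (addrI (lact a 0)); rewrite -lactDr !addr0.
Qed.

Lemma cmx_comul_linear : linear cmx_comul_fun.
Proof.
move=> a u v; rewrite cmx_comul_funD; congr (_ + _).
apply: (@cmx_eq B _ (fun u : CB => cmx_comul_fun (ract u a))
          (fun u => ract (cmx_comul_fun u) a)) => [x y|x y|phi x].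
- by rewrite ractDl cmx_comul_funD.
- by rewrite cmx_comul_funD ractDl.
- rewrite cmx_ract !cmx_comul_funE ract_sum; apply: eq_bigr => i _.
  by rewrite [RHS]ract_tpure [X in _ = tpure _ X]cmx_ract.
Qed.
HB.instance Definition _ := GRing.isLinear.Build A^c CB (tensAA CB CB) *:%R
  cmx_comul_fun cmx_comul_linear.
Lemma cmx_comulL a (u : CB) : cmx_comul_fun (lact a u) = lact a (cmx_comul_fun u).
Proof.
apply: (@cmx_eq B _ (fun u : CB => cmx_comul_fun (lact a u))
          (fun u => lact a (cmx_comul_fun u))) => [x y|x y|phi x].
- by rewrite lactDr cmx_comul_funD.
- by rewrite cmx_comul_funD lactDr.
- rewrite cmx_bimod_lact !cmx_comul_funE lact_sum; apply: eq_bigr => i _.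
  by rewrite lact_tpure cmx_bimod_lact.
Qed.
Definition cmx_comul : bimodHom CB (tensAA CB CB) :=
  @BimodHom K A CB (tensAA CB CB) cmx_comul_fun cmx_comulL.

Definition cmx_counit_fun : CB -> regbimod A :=
  tlift (fun (phi : dual) x => phi x).
Lemma cmx_counit_balanced : balanced (@dual_end B) (@end_act B)
  (fun (phi : dual) x => phi x : regbimod A).
Proof. by split=> // u x y; rewrite linearD. Qed.
#[local] Hint Resolve cmx_counit_balanced : core.
Lemma cmx_counit_funE phi x : cmx_counit_fun (tpure phi x : cmx B) = phi x.
Proof. exact: tliftE. Qed.
Lemma cmx_counit_funD : {morph cmx_counit_fun : x y / x + y}.
Proof. by move=> x y; apply: tliftD. Qed.
Lemma cmx_counit_linear : linear cmx_counit_fun.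
Proof.
move=> a u v; rewrite cmx_counit_funD; congr (_ + _).
apply: (@cmx_eq B _ (fun u : CB => cmx_counit_fun (ract u a))
          (fun u => ract (cmx_counit_fun u) a)) => [x y|x y|phi x].
- by rewrite ractDl cmx_counit_funD.
- by rewrite cmx_counit_funD ractDl.
- by rewrite cmx_ract !cmx_counit_funE ract_lin.
Qed.
HB.instance Definition _ := GRing.isLinear.Build A^c CB (regbimod A) *:%R
  cmx_counit_fun cmx_counit_linear.
Lemma cmx_counitL a (u : CB) :
  cmx_counit_fun (lact a u) = lact a (cmx_counit_fun u).
Proof.
apply: (@cmx_eq B _ (fun u : CB => cmx_counit_fun (lact a u))
          (fun u => lact a (cmx_counit_fun u))) => [x y|x y|phi x].
- by rewrite lactDr cmx_counit_funD.
- by rewrite cmx_counit_funD lactDr.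
- by rewrite cmx_bimod_lact !cmx_counit_funE.
Qed.
Definition cmx_counit : bimodHom CB (regbimod A) :=
  @BimodHom K A CB (regbimod A) cmx_counit_fun cmx_counitL.

Lemma cmx_comulE phi x : cmx_comul (tpure phi x : cmx B) =
  \sum_i tpure (tpure phi (e i) : cmx B) (tpure (e' i) x : cmx B).
Proof. exact: cmx_comul_funE. Qed.
Lemma cmx_comul_indep (d1 : dual_basis Sigma) phi x :
  cmx_comul (tpure phi x : cmx B) =
  \sum_i tpure (tpure phi (db_vec d1 i) : cmx B) (tpure (db_form d1 i) x : cmx B).
Proof.
rewrite cmx_comulE; apply: esym.
rewrite [LHS](@db_move (cmx B) CB d1 (tpure phi) (fun p => tpure p x : cmx B)
  (idfun : End) (rlin_tpure phi) (fun p q => tpureDl _ _ _ _ _)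
  (fun a p => esym (cmx_bimod_lact hB a p x))).
by apply: eq_bigr => i _; congr (tpure _ (tpure _ _)); apply: linear_ext.
Qed.
Lemma cmx_counitE phi x : cmx_counit (tpure phi x : cmx B) = phi x.
Proof. exact: cmx_counit_funE. Qed.

Definition sigma_coact_fun (x : Sigma) : tensA Sigma CB :=
  \sum_i tpure (e i) (tpure (e' i) x : cmx B).
Lemma sigma_coact_linear : linear sigma_coact_fun.
Proof.
move=> a x y; rewrite /sigma_coact_fun -[in RHS]/(ract _ a) ract_sum -big_split.
apply: eq_bigr => i _ /=; rewrite ract_tpure -[RHS]tpureDr; congr (tpure _ _).
by rewrite cmx_ract; apply: tpureDr.
Qed.
HB.instance Definition _ := GRing.isLinear.Build A^c Sigma (tensA Sigma CB) *:%R
  sigma_coact_fun sigma_coact_linear.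

Let rlD (M M' : lmodType A^c) N N' f g hf hg :=
  @tmap_rlD K A M M' N N' f g hf hg.

Lemma sigma_coactA (x : Sigma) :
  tassoc (tmap sigma_coact_fun id (sigma_coact_fun x)) =
    tmap id cmx_comul (sigma_coact_fun x).
Proof.
have hr : rlin sigma_coact_fun by exact: rlin_linear.
have hl : llin cmx_comul by exact: llin_bimod.
rewrite (additive_sum _ _ (rlD hr (llin_id _))).
rewrite (additive_sum _ _ (@tassocD _ _ _ _ _)).
rewrite (additive_sum _ _ (rlD (rlin_id _) hl)).
transitivity (\sum_i \sum_j tpure (e j) (tpure (tpure (e' j) (e i) : cmx B)
    (tpure (e' i) x : cmx B) : tensA CB CB) : tensA Sigma (tensAA CB CB)).
  apply: eq_bigr => i _; rewrite (tmap_rlE _ _ hr (llin_id _)).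
  rewrite [tpure (sigma_coact_fun _) _]tpureA_suml.
  rewrite (additive_sum _ _ (@tassocD _ _ _ _ _)).
  by apply: eq_bigr => j _; rewrite tassocE.
rewrite exchange_big /=; apply: eq_bigr => j _.
rewrite (tmap_rlE _ _ (rlin_id _) hl) cmx_comulE.
exact: (esym (@tpureA_sumr Sigma (tensAA CB CB) _ _
  (fun i => tpure (tpure (e' j) (e i) : cmx B) (tpure (e' i) x : cmx B)) (e j))).
Qed.

Lemma sigma_coact1 (x : Sigma) :
  tlift (fun y c => ract y (cmx_counit c)) (sigma_coact_fun x) = x.
Proof.
have bal : balanced (@ract _ _ Sigma) (@lact _ _ CB)
    (fun y c => ract y (cmx_counit c)).
  split=> [y z c|y b c|y a c]; rewrite ?ractDl ?linearD ?ractDr //.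
  by rewrite bimod_funL ractA.
rewrite tlift_sum // [RHS]db_ract; apply: eq_bigr => i _.
by rewrite tliftE // cmx_counitE.
Qed.

Lemma cmx_comulA c :
  tassoc (tmap cmx_comul id (cmx_comul c)) = tmap id cmx_comul (cmx_comul c).
Proof.
have hr : rlin cmx_comul by exact: rlin_linear.
have hl : llin cmx_comul by exact: llin_bimod.
apply: (@cmx_eq B _ (fun c => tassoc (tmap cmx_comul id (cmx_comul c)))
    (fun c => tmap id cmx_comul (cmx_comul c))) => [u v|u v|phi x].
- by rewrite linearD (rlD hr (llin_id _)) tassocD.
- by rewrite linearD (rlD (rlin_id _) hl).
rewrite cmx_comulE.
rewrite (additive_sum _ _ (rlD hr (llin_id _))).
rewrite (additive_sum _ _ (@tassocD _ _ _ _ _)).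
rewrite (additive_sum _ _ (rlD (rlin_id _) hl)).
transitivity (\sum_i \sum_j tpure (tpure phi (e j) : cmx B)
    (tpure (tpure (e' j) (e i) : cmx B)
    (tpure (e' i) x : cmx B) : tensA CB CB) : tensA CB (tensAA CB CB)).
  apply: eq_bigr => i _; rewrite (tmap_rlE _ _ hr (llin_id _)) cmx_comulE.
  rewrite [tpure (\sum_i _) _]tpureA_suml.
  rewrite (additive_sum _ _ (@tassocD _ _ _ _ _)).
  by apply: eq_bigr => j _; rewrite tassocE.
rewrite exchange_big /=; apply: eq_bigr => j _.
rewrite (tmap_rlE _ _ (rlin_id _) hl) cmx_comulE.
exact: (esym (@tpureA_sumr CB (tensAA CB CB) _ _
  (fun i => tpure (tpure (e' j) (e i) : cmx B) (tpure (e' i) x : cmx B))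
  (tpure phi (e j) : cmx B))).
Qed.

Lemma cmx_counitl c :
  tlift (fun x y => lact (cmx_counit x) y) (cmx_comul c) = c.
Proof.
have bal : balanced (@ract _ _ CB) (@lact _ _ CB)
   (fun x y => lact (cmx_counit x) y : CB).
  split=> [y z t|y t z|y a t]; rewrite ?lactDr ?linearD ?lactDl //.
  by rewrite ract_lin lactA.
apply: (@cmx_eq B _ (fun c => tlift (fun x y => lact (cmx_counit x) y) (cmx_comul c))
   id) => [u v|u v|phi x] //.
  by rewrite linearD tliftD.
rewrite cmx_comulE tlift_sum //.
rewrite [in RHS](db_dual phi).
rewrite [RHS](big_morph (fun p => tpure p x : CB) (id1 := 0) (op1 := +%R)) /=.
- by apply: eq_bigr => i _; rewrite tliftE // cmx_counitE; apply: cmx_bimod_lact.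
- by move=> p q; apply: tpureDl.
- by apply: (addrI (tpure 0 x : CB)); rewrite -[LHS]tpureDl !addr0.
Qed.

Lemma cmx_counitr c :
  tlift (fun x y => ract x (cmx_counit y)) (cmx_comul c) = c.
Proof.
have bal : balanced (@ract _ _ CB) (@lact _ _ CB)
   (fun x y => ract x (cmx_counit y) : CB).
  split=> [y z t|y t z|y a t]; rewrite ?ractDl ?linearD ?ractDr //.
  by rewrite bimod_funL ractA.
apply: (@cmx_eq B _ (fun c => tlift (fun x y => ract x (cmx_counit y)) (cmx_comul c))
   id) => [u v|u v|phi x] //.
  by rewrite linearD tliftD.
rewrite cmx_comulE tlift_sum //.
rewrite [in RHS](db_ract x).
rewrite [RHS](big_morph (fun y => tpure phi y : CB) (id1 := 0) (op1 := +%R)) /=.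
- by apply: eq_bigr => i _; rewrite tliftE // cmx_counitE; apply: cmx_ract.
- by move=> p q; apply: tpureDr.
- by apply: (addrI (tpure phi 0 : CB)); rewrite -[LHS]tpureDr !addr0.
Qed.

Definition comatrix_coring : coring A :=
  @Coring K A CB cmx_comul cmx_counit cmx_comulA cmx_counitl cmx_counitr.

Definition sigma_comod : comodule comatrix_coring :=
  @Comodule K A comatrix_coring Sigma sigma_coact_fun sigma_coactA sigma_coact1.

(* End(Sigma_{C/J}), as a set of endomorphisms of Sigma_A. *)
Definition quot_endo (J : set comatrix_coring) (hJ : coideal J) : set End :=
  [set f : End | @is_comod_map K A (quot_coring hJ)
     (push_comod (quot_proj hJ) sigma_comod)
     (push_comod (quot_proj hJ) sigma_comod) f]%classic.

End Coring.
End Comatrix.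

(* Main.v *)
Require Import Defs.
From HB Require Import structures.
From mathcomp Require Import all_boot all_order all_algebra.
From mathcomp Require Import boolp classical_sets.

(* Let p : C -> D be a surjective map of corings, write p(phi, x) for the image
   of phi (x) x, and let T = End(Sigma_D).  A linear f belongs to T exactly when
   p(phi f, x) = p(phi, f x) for all phi and x, so T is a division ring by
   Schur's lemma.  As a right A-module D is a sum of copies of the simple module
   Sigma, hence every nonzero map Sigma -> D has a linear retraction.  A
   Gram-Schmidt process over T with such retractions shows that the kernel of p
   is that of Sigma^* (x)_B Sigma -> Sigma^* (x)_T Sigma, and that every nonzero
   c in D is mapped to a nonzero element of Sigma by some linear map which is
   colinear at c; with the left coaction this makes D a simple coring.

   Conversely let ker p be the kernel for some division ring T.  A left T-linear
   functional l : Sigma -> T induces D -> Sigma^*, p(phi, x) |-> phi l(x).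
   Applied to p(phi f, x) = p(phi, f x) with l(x) = 1 it gives f = l(f x), so
   End(Sigma_D) = T.  Contracting the coaction of a comodule M along it turns
   each m in M into colinear maps Sigma -> M whose images generate m.  So every
   comodule is a sum, hence by Zorn's lemma a direct sum, of copies of Sigma;
   bases of M and N make every colinear f : M -> N von Neumann regular
   (f g f = f), and kernels, cokernels and normality of monomorphisms and
   epimorphisms come from splitting the idempotents 1 - g f and 1 - f g. *)

Set Implicit Arguments.
Unset Strict Implicit.
Unset Printing Implicit Defensive.

Import GRing.Theory.
Local Open Scope ring_scope.

(** * Retractions onto simple submodules *)

Lemma additive0 (X Y : zmodType) (f : X -> Y) : {morph f : x y / x + y} -> f 0 = 0.
Proof. by move=> fD; apply: (addrI (f 0)); rewrite -fD !addr0. Qed.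

Lemma additiveN (X Y : zmodType) (f : X -> Y) :
  {morph f : x y / x + y} -> {morph f : x / - x}.
Proof.
by move=> fD x; apply: (addrI (f x)); rewrite -fD !subrr (additive0 fD).
Qed.

Lemma additiveB (X Y : zmodType) (f : X -> Y) :
  {morph f : x y / x + y} -> {morph f : x y / x - y}.
Proof. by move=> fD x y; rewrite fD (additiveN fD). Qed.

Lemma additive_big (X Y : zmodType) (f : X -> Y) I (r : seq I) (P : pred I) (F : I -> X) :
  {morph f : x y / x + y} -> f (\sum_(i <- r | P i) F i) = \sum_(i <- r | P i) f (F i).
Proof. by move=> fD; apply: (big_morph f fD); apply: additive0. Qed.

(** * Abelian groups with additive operators: right modules and left vector spaces at once *)

Section OperatorGroups.
Variables (X : zmodType) (I : Type) (act : I -> X -> X).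
Hypothesis actD : forall i, {morph act i : x y / x + y}.

Definition op_closed (U : set X) :=
  (forall x y, U x -> U y -> U (x - y)) /\ (forall i x, U x -> U (act i x)).

Definition op_submodule (U : set X) := U 0 /\ op_closed U.

Lemma op_closedD U x y : op_submodule U -> U x -> U y -> U (x + y).
Proof.
move=> [U0 [UB _]] Ux Uy; rewrite -[y]opprK; apply: (UB) => //.
by rewrite -sub0r; apply: (UB).
Qed.

Lemma op_submodule_add U V : op_submodule U -> op_submodule V ->
  op_submodule [set x | exists u v, [/\ U u, V v & x = u + v]]%classic.
Proof.
move=> [U0 [UB UA]] [V0 [VB VA]]; split; first by exists 0, 0; rewrite addr0.
split=> [_ _ [u [v [Uu Vv ->]]] [u' [v' [Uu' Vv' ->]]]|i _ [u [v [Uu Vv ->]]]].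
  by exists (u - u'), (v - v'); split; rewrite ?opprD 1?addrACA; auto.
by exists (act i u), (act i v); rewrite actD; split; auto.
Qed.

(** Complements in a sum of simple pieces: [W] is maximal among the closed sets meeting [N] at most
    in zero, and [N + W] then absorbs every [L j]. The alternative imposed on [L j] allows it to be
    simple or zero. *)
Lemma complement_exists (J : Type) (L : J -> set X) (N : set X) :
  op_submodule N -> (forall j, op_submodule (L j)) ->
  (forall j U, op_submodule U ->
     (L j `<=` U)%classic \/ forall x, L j x -> U x -> x = 0) ->
  (forall U, op_submodule U -> (forall j, L j `<=` U)%classic -> forall x, U x) ->
  exists W, [/\ op_submodule W, forall x, N x -> W x -> x = 0
    & forall x, exists n, N n /\ W (x - n)].
Proof.
move=> hN hL Lsimple Lspan.
(* The empty set is allowed so that the union of the empty chain qualifies. *)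
pose P (W : set X) := op_closed W /\ forall x, N x -> W x -> x = 0.
have [|W [[cW WN] Wmax]] := @Zorn_bigcup X P.
  move=> F FP Ftot; split; last first.
    by move=> x Nx [U FU Ux]; have [_] := FP _ FU; apply.
  split=> [x y [U FU Ux] [V FV Vy]|i x [U FU Ux]].
    case: (Ftot U V FU FV) => h.
      by exists V => //; have [[+ _] _] := FP _ FV; apply=> //; apply: h.
    by exists U => //; have [[+ _] _] := FP _ FU; apply=> //; apply: h.
  by exists U => //; have [[_ +] _] := FP _ FU; apply.
(* An empty [W] would not be maximal, since the zero submodule properly contains it. *)
have W0 : W 0.
  apply: contrapT => nW0; pose Z : set X := [set 0]%classic.
  have Wempty x : ~ W x by move=> Wx; apply: nW0; rewrite -(subrr x); apply cW.1.
  apply: (Wmax Z).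
    rewrite properEneq; split; last by move=> x /Wempty.
    by apply/eqP => E; apply: nW0; rewrite E.
  split; last by move=> x _ /= ->.
  by split=> [x y /= -> ->|i x /= ->]; rewrite ?subrr ?(additive0 (actD i)).
have hW : op_submodule W by [].
exists W; split=> // x.
pose NW : set X := [set x | exists u v, [/\ N u, W v & x = u + v]]%classic.
have hNW : op_submodule NW by apply: op_submodule_add.
suff [n [v [Nn Wv ->]]] : NW x by exists n; rewrite addrAC subrr add0r.
(* If [L j] meets [N + W] only in zero, then [W + L j] still meets [N] only in zero, so by
   maximality [L j] already lies in [W]. *)
move: x; apply: (Lspan) => // j; case: (Lsimple j NW hNW) => // Lj0.
pose WL : set X := [set x | exists u v, [/\ W u, L j v & x = u + v]]%classic.
have hWL : op_submodule WL by apply: op_submodule_add.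
have W_WL : (W `<=` WL)%classic.
  by move=> w Ww; exists w, 0; rewrite addr0; split=> //; case: (hL j).
have WL_W : (WL `<=` W)%classic.
  apply: contrapT => nsub; apply: (Wmax WL).
    by rewrite properEneq; split=> //; apply/eqP => E; apply: nsub; rewrite -E.
  split=> [|n Nn [w [l [Ww Ll E]]]]; first by case: hWL.
  have l0 : l = 0.
    apply: Lj0 => //; exists n, (- w); split=> //; last first.
      by rewrite E addrAC subrr add0r.
    by rewrite -sub0r; apply cW.1.
  by apply: (WN); rewrite // E l0 addr0.
move=> l Ll; exists 0, l; rewrite add0r; split=> //; first by case: hN.
by apply: WL_W; exists 0, l; rewrite add0r.
Qed.

(** [q x] is the unique [y] in [V] for which [x - r y] lies in a complement of the image of [V]. The
    source is a subset [V] of [Y] so that it can be a division subring inside the endomorphism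
    ring. *)
Lemma retraction_exists (J : Type) (L : J -> set X)
    (Y : zmodType) (actY : I -> Y -> Y) (V : set Y) (r : Y -> X) :
  (forall j, op_submodule (L j)) ->
  (forall j U, op_submodule U ->
     (L j `<=` U)%classic \/ forall x, L j x -> U x -> x = 0) ->
  (forall U, op_submodule U -> (forall j, L j `<=` U)%classic -> forall x, U x) ->
  V 0 -> (forall y z, V y -> V z -> V (y - z)) -> (forall i y, V y -> V (actY i y)) ->
  {morph r : x y / x + y} -> (forall i y, V y -> r (actY i y) = act i (r y)) ->
  (forall y, V y -> r y = 0 -> y = 0) ->
  exists q : X -> Y, [/\ forall x, V (q x), {morph q : x y / x + y},
    forall i x, q (act i x) = actY i (q x) & forall y, V y -> q (r y) = y].
Proof.
move=> hL Lsimple Lspan V0 VB VA rD rA rI; have rB := additiveB rD.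
pose N : set X := [set r y | y in V]%classic.
have hN : op_submodule N.
  split; first by exists 0; rewrite ?(additive0 rD).
  split=> [_ _ [y Vy <-] [z Vz <-]|i _ [y Vy <-]].
    by exists (y - z); rewrite ?rB //; apply: (VB).
  by exists (actY i y); rewrite ?rA //; apply: (VA).
have [W [hW WN Wspan]] := complement_exists hN hL Lsimple Lspan.
have [W0 [WB WA]] := hW.
have Vuniq x y z : V y -> V z -> W (x - r y) -> W (x - r z) -> y = z.
  move=> Vy Vz hy hz; apply/eqP; rewrite -subr_eq0; apply/eqP; apply: rI.
    exact: VB.
  rewrite rB; apply: (WN); first by exists (y - z); rewrite ?rB //; apply: (VB).
  have -> : r y - r z = (x - r z) - (x - r y).
    by rewrite opprB [RHS]addrC addrA subrK.
  exact: WB.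
have VD y z : V y -> V z -> V (y + z).
  by move=> Vy Vz; rewrite -[z]opprK; apply: (VB) => //; rewrite -sub0r; apply: (VB).
have qex x : exists y, V y /\ W (x - r y).
  by have [_ [[y Vy <-] Wy]] := Wspan x; exists y.
have [q hq] := choice qex.
exists q; split=> [x|x y|i x|y Vy]; first by case: (hq x).
- have [[[? ?] [? ?]] [? ?]] := (hq x, hq y, hq (x + y)).
  apply: (@Vuniq (x + y)); rewrite ?rD 1?opprD 1?addrACA //; first exact: VD.
  exact: op_closedD.
- have [[? ?] [? ?]] := (hq x, hq (act i x)).
  apply: (@Vuniq (act i x)) => //; first exact: VA.
  by rewrite rA // -(additiveB (actD i)); apply: WA.
- by have [? ?] := hq (r y); apply: (@Vuniq (r y)) => //; rewrite subrr.
Qed.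

End OperatorGroups.

(** * Schur's lemma *)

Section Schur.
Variables (R : pzRingType) (M : lmodType R).
Hypothesis simpleM : simple_module M.

Lemma simple_op_submodule (U : set M) : op_submodule (@GRing.scale R M) U ->
  (forall x, U x -> x = 0) \/ (forall x, U x).
Proof.
move=> [U0 [UB UA]]; have [|->|->] := simpleM.2 U; [|by left|by right].
split=> [|a x y]; rewrite !inE // => Ux Uy.
rewrite -[y]opprK; apply: (UB); first exact: UA.
by rewrite -sub0r; apply: (UB).
Qed.

Lemma simple_injective (N : lmodType R) (f : {linear M -> N}) x :
  f x != 0 -> injective f.
Proof.
move=> fx0; pose U : set M := [set y | f y = 0]%classic.
have [|U0|/(_ x) fx] := @simple_op_submodule U.
- split; first by rewrite /U /= linear0.
  split=> [y z|a y]; rewrite /U /= ?linearB ?linearZZ => ->; first by move=> ->; rewrite subrr.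
  by rewrite scaler0.
- move=> y z fyz; apply/eqP; rewrite -subr_eq0; apply/eqP/U0.
  by rewrite /U /= linearB fyz subrr.
- by rewrite fx eqxx in fx0.
Qed.

Lemma simple_endo_unit (f : {linear M -> M}) : f != 0 ->
  exists g : {linear M -> M}, f * g = 1 /\ g * f = 1.
Proof.
move=> f0; have [x fx0] : exists x, f x != 0.
  apply: contrapT => nx; case/negP: f0; apply/eqP/linear_ext => x.
  by apply/eqP; apply: contrapT => /negP fx; apply: nx; exists x.
have finj := simple_injective fx0.
have fsurj y : exists z, f z = y.
  have [|im0|im] := @simple_op_submodule [set y | exists z, f z = y]%classic.
    split; first by exists 0; rewrite linear0.
    split=> [_ _ [u <-] [v <-]|a _ [u <-]]; first by exists (u - v); rewrite linearB.
    by exists (a *: u); rewrite linearZZ.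
    by case/eqP: fx0; apply: im0; exists x.
  exact: im y.
have [g gK] := choice fsurj.
have g_lin : linear g by move=> a u v; apply: finj; rewrite linearP !gK.
pose gL := GRing.isLinear.Build R M M *:%R g g_lin.
pose G : {linear M -> M} := HB.pack g gL.
exists G; split; apply: linear_ext => y; first exact: gK.
by apply: finj; rewrite [LHS]gK.
Qed.

End Schur.

(** * Linear functionals with values in a division subring of endomorphisms *)

Section TwistedFunctionals.
Variables (K : comPzRingType) (A : algType K) (Sigma : lmodType A^c).
Local Notation End := {linear Sigma -> Sigma}.
Variable T : set End.
Hypothesis divT : is_division_subring T.

Lemma subring1 (B : set End) : is_subring B -> B 1.
Proof. by move=> [[+ _ _] _]; rewrite inE. Qed.
Lemma subringB (B : set End) f g : is_subring B -> B f -> B g -> B (f - g).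
Proof. by move=> [[_ + _] _] Bf Bg => /(_ f g); rewrite !inE; apply. Qed.
Lemma subringM (B : set End) f g : is_subring B -> B f -> B g -> B (f * g).
Proof. by move=> [[_ _ +] _] Bf Bg => /(_ f g); rewrite !inE; apply. Qed.
Lemma subring0 (B : set End) : is_subring B -> B 0.
Proof. by move=> hB; rewrite -(subrr 1); apply: subringB => //; apply: subring1. Qed.

(** The dual space of [Sigma] as a left [T]-vector space. Values are endomorphisms with a membership
    proof because [T] is a set rather than a type. *)
Record functional := Functional {
  functional_fun :> Sigma -> End;
  functional_mem : forall x, T (functional_fun x);
  functionalD : {morph functional_fun : x y / x + y};
  functionalM : forall t x, T t -> functional_fun (t x) = t * functional_fun x
}.

(** The lines [T y] are zero or simple and cover [Sigma], and [t |-> t x] is injective on [T]; a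
    [T]-linear retraction of it is the functional. *)
Lemma functional_exists x : x <> 0 -> exists l : functional, l x = 1.
Proof.
move=> x0; have [hT one0 inv] := divT.
pose L (y : Sigma) : set Sigma := [set t y | t in T]%classic.
have TL y : op_submodule (fun (t : {t | T t}) z => sval t z) (L y).
  split; first by exists 0 => //; apply: subring0.
  split=> [_ _ [s Ts <-] [t Tt <-]|[s Ts] _ [t Tt <-]].
    by exists (s - t) => //; apply: subringB.
  by exists (s * t) => //; apply: subringM.
have [||||||||||q [qT qD qA q1]] := @retraction_exists Sigma {t : End | T t} (fun t z => sval t z)
   _ Sigma L End (fun t f => sval t * f) T (fun f => f x) => //.
- by move=> [t Tt] u v /=; rewrite linearD.
- move=> y U [U0 [UB UA]]; case: (pselect (U y)) => Uy.
    by left=> _ [t Tt <-]; apply: (UA (exist _ t Tt)).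
  right=> _ [t Tt <-] Uty; case: (eqVneq t 0) => [-> //|/(inv t Tt)[g [Tg _ gt]]].
  case: Uy; have := UA (exist _ g Tg) _ Uty => /=.
  by rewrite -[g (t y)]/((g * t) y) gt.
- move=> U _ LU y; apply: (LU y); exists 1 => //; exact: subring1.
- exact: subring0.
- by move=> f g Tf Tg; apply: subringB.
- by move=> [t Tt] f Tf; apply: subringM.
- move=> t Tt tx; apply/eqP; apply: contrapT => /negP/(inv t Tt)[g [_ _ gt]].
  by apply: x0; rewrite -[x]/((1 : End) x) -gt linend_mulE tx linear0.
exists (@Functional q qT qD (fun t y Tt => qA (exist _ t Tt) y)).
by apply: (q1 1); apply: subring1.
Qed.

Definition functional_comp (p : Sigma -> Sigma) (l : functional) :
  {morph p : x y / x + y} -> (forall t x, T t -> p (t x) = t (p x)) -> functional.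
Proof.
move=> pD pT; refine (@Functional (l \o p) _ _ _) => [x|x y|t x Tt] /=.
- exact: functional_mem.
- by rewrite pD functionalD.
- by rewrite pT // functionalM.
Defined.

(** A dual basis identity asked only on finitely many vectors, since [Sigma] may be infinite
    dimensional over [T]. *)
Lemma dual_system (xs : seq Sigma) : exists s : seq (functional * Sigma),
  forall x, x \in xs -> x = \sum_(p <- s) p.1 x p.2.
Proof.
elim: xs => [|x xs [s IH]]; first by exists [::].
(* [p] is the [T]-linear defect of [s]. It kills [xs], so adjoining [p x] with a functional composed
   with [p] repairs [x] without disturbing [xs]. *)
pose p y := y - \sum_(q <- s) q.1 y q.2.
have p_xs y : y \in xs -> p y = 0 by move=> /IH E; rewrite /p -E subrr.
case: (pselect (p x = 0)) => px.
  exists s => y; rewrite inE => /predU1P[->|/IH//].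
  by apply/eqP; rewrite -subr_eq0; apply/eqP.
have pD : {morph p : u v / u + v}.
  move=> u v; rewrite /p addrACA -opprD -big_split; congr (_ + - _).
  by apply: eq_bigr => q _; rewrite functionalD.
have pT t y : T t -> p (t y) = t (p y).
  move=> Tt; rewrite /p (linearB t) (linear_sum t); congr (_ - _).
  by apply: eq_bigr => q _; rewrite functionalM.
have [l lpx] := functional_exists px.
exists ((functional_comp l pD pT, p x) :: s) => y; rewrite inE big_cons /=.
case/predU1P => [->|yxs]; first by rewrite lpx linend_oneE subrK.
by rewrite p_xs // (additive0 (functionalD l)) add0r; apply: IH.
Qed.

End TwistedFunctionals.

(** * Quotients of the comatrix coring *)

Lemma cmx_projD (K : comPzRingType) (A : algType K) (Sigma : lmodType A^c)
    (B T : set {linear Sigma -> Sigma}) : (B `<=` T)%classic ->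
  {morph @cmx_proj _ _ Sigma B T : u v / u + v}.
Proof.
move=> BT u v; apply: tliftD; split=> [*|*|f r x]; rewrite ?tpureDl ?tpureDr //.
exact: (@tpureA _ _ _ (@dual_end _ _ _ T) (@end_act _ _ _ T) f
          (exist T (sval r) (BT _ (svalP r))) x).
Qed.

Section CoringQuotient.
Variables (K : comPzRingType) (A : algType K) (Sigma : lmodType A^c).
Local Notation End := {linear Sigma -> Sigma}.
Local Notation dual := {linear Sigma -> (A^c)^o}.
Variables (d : dual_basis Sigma) (B : set End) (hB : is_subring B).
Local Notation e := (db_vec d).
Local Notation e' := (db_form d).
Local Notation CB := (comatrix_coring d hB).
Variables (D : coring A) (p : coringHom CB D).

Definition qpure (phi : dual) (x : Sigma) : D := p (tpure phi x : cmx B).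

Lemma qpure_is_linear phi : linear (qpure phi).
Proof.
move=> a x y; rewrite /qpure -[a *: p _]/(ract (p _) a) -ract_lin -linearD.
by congr (p _); rewrite [X in _ = X + _](@cmx_ract _ _ _ B a phi x); apply: tpureDr.
Qed.
HB.instance Definition _ phi :=
  GRing.isLinear.Build A^c Sigma D *:%R (qpure phi) (qpure_is_linear phi).

Lemma qpureD phi : {morph qpure phi : x y / x + y}.
Proof. by move=> x y; rewrite linearD. Qed.
Lemma qpure_ract phi x a : qpure phi (ract x a) = ract (qpure phi x) a.
Proof. exact: (linearZZ (qpure phi)). Qed.
Lemma qpureDl x : {morph qpure^~ x : phi psi / phi + psi}.
Proof. by move=> phi psi; rewrite /qpure -linearD; congr (p _); apply: tpureDl. Qed.
Lemma qpure_lact a phi x : qpure (dual_lact a phi) x = lact a (qpure phi x).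
Proof. by rewrite /qpure -bimod_funL; congr (p _); rewrite cmx_bimod_lact. Qed.
Lemma qpure_end (phi : dual) (b : End) x : B b -> qpure (phi \o b) x = qpure phi (b x).
Proof. by move=> Bb; congr (p _); apply: (cmxA phi (exist _ b Bb)). Qed.

Definition qcomod : comodule D := push_comod p (sigma_comod d hB).

Lemma qcoactE (x : Sigma) :
  coact qcomod x = \sum_i tpure (e i) (qpure (e' i) x).
Proof.
rewrite -[LHS]/(tmap (@id Sigma) p (sigma_coact_fun d hB x)).
have [h _] := rlin_tmap (rlin_id Sigma) (llin_bimod p) (rlin_linear p).
rewrite (additive_big _ _ _ h); apply: eq_bigr => i _.
by rewrite (tmap_rlE _ _ (rlin_id _) (llin_bimod p)).
Qed.

(** Each [qpure phi] is thereby a comodule map from [Sigma] to [D]. *)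
Lemma comul_qpure phi x :
  comul D (qpure phi x) = tmap (qpure phi) id (coact qcomod x).
Proof.
rewrite /qpure coring_funM cmx_comulE qcoactE.
have hD := tmap_rlD (rlin_linear p) (llin_bimod p).
have hD' := tmap_rlD (rlin_linear (qpure phi)) (llin_id D).
rewrite (additive_big _ _ _ hD) (additive_big _ _ _ hD').
apply: eq_bigr => i _.
by rewrite (tmap_rlE _ _ (rlin_linear p) (llin_bimod p))
  (tmap_rlE _ _ (rlin_linear (qpure phi)) (llin_id D)).
Qed.

Lemma counit_qpure phi x : counit D (qpure phi x) = phi x.
Proof. by rewrite /qpure coring_fun1 -[LHS]/(cmx_counit hB _) cmx_counitE. Qed.

Lemma contract_balanced (N : lmodType A^c) (M : bimodule A) (f : {linear N -> (A^c)^o}) :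
  balanced (@ract _ _ N) (@lact _ _ M) (fun x y => lact (f x : A) y).
Proof.
split=> [x x' y|x y y'|x a y]; rewrite ?lactDr ?linearD ?lactDl //.
by rewrite ract_lin lactA.
Qed.

(** Applying [phi] to the first legs leaves the dual basis expansion of [phi] inside [qpure]. Such
    contractions turn identities between coactions into identities in [D]. *)
Lemma qcoact_contract (phi : dual) (x : Sigma) :
  tlift (fun y c => lact (phi y : A) c) (coact qcomod x) = qpure phi x.
Proof.
rewrite qcoactE tlift_sum; last exact: contract_balanced.
rewrite [in RHS](db_dual d phi) (additive_big _ _ _ (@qpureDl x)).
apply: eq_bigr => i _; rewrite qpure_lact.
exact: (tliftE _ _ (contract_balanced D phi)).
Qed.

(** One direction contracts the colinearity of [f] with [phi]; the other uses [db_move] to carry [f]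
    from the vectors to the forms of the dual basis. *)
Lemma qendoP (f : End) : @is_comod_map K A D qcomod qcomod f <->
  forall (phi : dual) x, qpure (phi \o f) x = qpure phi (f x).
Proof.
split=> [hf phi x|hf x].
  rewrite -[RHS]qcoact_contract hf -[LHS]qcoact_contract.
  apply: (@tens_fun_eq _ _ _ _ _ _
     (tlift (fun y c => lact ((phi \o f : dual) y : A) c))
     (fun t => tlift (fun y c => lact (phi y : A) c) (tmap f id t))) => [u v|u v|y c].
  - by apply: tliftD; apply: contract_balanced.
  - rewrite (tmap_rlD (rlin_linear f) (llin_id D)).
    by apply: tliftD; apply: contract_balanced.
  - rewrite (tmap_rlE _ _ (rlin_linear f) (llin_id D)).
    rewrite [LHS](tliftE _ _ (contract_balanced D (phi \o f : dual))).
    by rewrite [RHS](tliftE _ _ (contract_balanced D phi)).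
rewrite !qcoactE (additive_big _ _ _ (tmap_rlD (rlin_linear f) (llin_id D))).
have := @db_move K A Sigma d Sigma D d idfun (fun phi => qpure phi x) f
    (rlin_id _) (@qpureDl x) (fun a phi => qpure_lact a phi x).
under [X in _ = X -> _]eq_bigr do rewrite hf.
move=> <-; apply: eq_bigr => i _.
by rewrite (tmap_rlE _ _ (rlin_linear f) (llin_id D)).
Qed.

Hypothesis psurj : forall c, exists u, p u = c.

Lemma qpure_ind (Q : D -> Prop) : Q 0 -> (forall u v, Q u -> Q v -> Q (u + v)) ->
  (forall phi x, Q (qpure phi x)) -> forall c, Q c.
Proof.
move=> Q0 QD Qp c; have [u <-] := psurj c.
elim/tens_ind: u => [|u v Qu Qv|phi x]; first by rewrite linear0.
  by rewrite linearD; apply: QD.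
exact: Qp.
Qed.

Lemma qpure_eq (P : zmodType) (f g : D -> P) :
  {morph f : x y / x + y} -> {morph g : x y / x + y} ->
  (forall phi x, f (qpure phi x) = g (qpure phi x)) -> f =1 g.
Proof.
move=> fD gD h; apply: qpure_ind => [|u v hu hv|//].
  by rewrite (additive0 fD) (additive0 gD).
by rewrite fD gD hu hv.
Qed.

Lemma qpure_sum c : exists s : seq (dual * Sigma), c = \sum_(q <- s) qpure q.1 q.2.
Proof.
elim/qpure_ind: c => [|u v [s ->] [t ->]|phi x]; first by exists [::]; rewrite big_nil.
  by exists (s ++ t); rewrite big_cat.
by exists [:: (phi, x)]; rewrite big_seq1.
Qed.

Hypothesis simpleS : simple_module Sigma.

Definition qend : set End := [set f | @is_comod_map K A D qcomod qcomod f]%classic.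

Lemma qend_division : is_division_subring qend /\ (B `<=` qend)%classic.
Proof.
have BT : (B `<=` qend)%classic.
  by move=> b Bb; apply/qendoP => phi x; apply: qpure_end.
split=> //; split.
- split; last by move=> k; apply: BT; apply hB.2.
  split; rewrite ?inE; first by apply: BT; apply: subring1.
    move=> f g; rewrite !inE /qend /= !qendoP => hf hg phi x.
    rewrite -[RHS]/(qpure phi (f x - g x)) (additiveB (@qpureD phi)) -hf -hg.
    rewrite -(additiveB (@qpureDl x)); congr (qpure _ x).
    by apply: linear_ext => y /=; rewrite linearB.
  move=> f g; rewrite !inE /qend /= !qendoP => hf hg phi x.
  rewrite -[RHS]/(qpure phi (f (g x))) -hf -hg; congr (qpure _ x).
  exact: linear_ext.
- apply/eqP => E; have [x x0] := simpleS.1; apply: x0.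
  by rewrite -[x]/((1 : End) x) E.
- move=> f hf /(simple_endo_unit simpleS)[g [fg gf]]; exists g; split=> //.
  move: hf; rewrite /qend /= !qendoP => hf phi x.
  have fgE y : f (g y) = y by rewrite -linend_mulE fg.
  (* Writing [x] as [f (g x)] lets [f] move into the left factor, where it cancels against [g]. *)
  rewrite -{1}[x]fgE -[LHS]hf; congr (qpure _ _); apply: linear_ext => y.
  by rewrite -[RHS]/(phi ((1 : End) y)) -gf.
Qed.
(** The ranges of the maps [qpure phi] span [D], and each is zero or a copy of the simple module
    [Sigma], so the image of the injective map [r] has a complement. *)
Lemma qretraction (r : {linear Sigma -> D}) x : r x != 0 ->
  exists q : {linear D -> Sigma}, forall y, q (r y) = y.
Proof.
move=> rx0; have rinj := simple_injective simpleS rx0.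
have sub0 : op_submodule (@GRing.scale A^c D) [set 0]%classic.
  split=> //; split=> [u v /= -> ->|a u /= ->]; [exact: subr0|exact: scaler0].
have pre U phi : op_submodule (@GRing.scale A^c D) U ->
    op_submodule (@GRing.scale A^c Sigma) [set y | U (qpure phi y)]%classic.
  move=> [U0 [UB UA]]; split; first by rewrite /= linear0.
  split=> [y z Uy Uz|a y Uy] /=; first by rewrite linearB; apply: (UB).
  by rewrite linearZZ; apply: (UA).
have [||||||||||q [_ qD qA q1]] := @retraction_exists D A^c (@GRing.scale A^c D)
   _ dual (fun phi => range (qpure phi)) Sigma (@GRing.scale A^c Sigma) setT r => //.
- by move=> a u v; apply: scalerDr.
- move=> phi; split; first by exists 0; rewrite ?linear0.
  split=> [_ _ [y _ <-] [z _ <-]|a _ [y _ <-]].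
    by exists (y - z); rewrite ?linearB.
  by exists (a *: y); rewrite ?linearZZ.
- move=> phi U /(pre U phi)/(simple_op_submodule simpleS)[U0|UT].
    by right=> _ [y _ <-] /U0 ->; rewrite linear0.
  by left=> _ [y _ <-]; apply: UT.
- move=> U [U0 [UB UA]] LU; apply: qpure_ind => // [u v Uu Uv|phi y].
    by apply: (@op_closedD _ _ (@GRing.scale A^c D)).
  by apply: (LU phi); exists y.
- by move=> y z; rewrite linearD.
- by move=> a y _; rewrite linearZZ.
- by move=> y _ ry0; apply: rinj; rewrite ry0 linear0.
have q_lin : linear q by move=> a u v; rewrite qD qA.
pose qL := GRing.isLinear.Build A^c D Sigma *:%R q q_lin.
pose Q : {linear D -> Sigma} := HB.pack q qL.
by exists Q => y; apply: q1.
Qed.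

(** Colinearity is asked at a single element because the retractions constructed below are only
    known to be colinear on the sum of finitely many ranges of maps [qpure phi]. *)
Definition colinear_at (q : {linear D -> Sigma}) (c : D) :=
  coact qcomod (q c) = tmap q id (comul D c).

Lemma colinear_atD q c c' : colinear_at q c -> colinear_at q c' -> colinear_at q (c + c').
Proof.
rewrite /colinear_at !linearD => -> ->.
by rewrite (tmap_rlD (rlin_linear q) (llin_id D)).
Qed.


(** By [comul_qpure] the map [qpure phi] is colinear, so colinearity of [q] on its range is that of
    the composite. *)
Lemma colinear_atP (q : {linear D -> Sigma}) (phi : dual) :
  qend (q \o qpure phi) <-> forall x, colinear_at q (qpure phi x).
Proof.
rewrite /qend /colinear_at /=; split=> h x.
  rewrite comul_qpure.
  rewrite (tmap_comp _ (rlin_linear (qpure phi)) (llin_id D) (rlin_linear q) (llin_id D)).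
  exact: h.
rewrite [LHS]h comul_qpure.
by rewrite (tmap_comp _ (rlin_linear (qpure phi)) (llin_id D) (rlin_linear q) (llin_id D)).
Qed.

(** * The Gram-Schmidt process over the endomorphism ring of the comodule *)

Section Deflation.
Variable s : seq (dual * {linear D -> Sigma}).

Definition partial_id (c : D) : D := \sum_(t <- s) qpure t.1 (t.2 c).

Lemma partial_id_is_linear : linear partial_id.
Proof.
move=> a u v; rewrite /partial_id scaler_sumr -big_split; apply: eq_bigr => t _ /=.
by rewrite !linearP.
Qed.
HB.instance Definition _ :=
  GRing.isLinear.Build A^c D D *:%R partial_id partial_id_is_linear.

(** The part of [c] that the system [s] does not yet reproduce. *)
Definition residue (c : D) : D := c - partial_id c.
Lemma residue_is_linear : linear residue.
Proof.
move=> a u v; rewrite /residue (linearP partial_id) scalerBr.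
by rewrite opprD addrACA.
Qed.
HB.instance Definition _ :=
  GRing.isLinear.Build A^c D D *:%R residue residue_is_linear.
End Deflation.

Lemma qend0 : qend 0.
Proof. by have [[h _ _] _] := qend_division; apply: subring0. Qed.

Lemma residue0E s c : residue s c = 0 -> c = \sum_(t <- s) qpure t.1 (t.2 c).
Proof. by move/eqP; rewrite subr_eq0 => /eqP. Qed.

(** Induction on [phis]. Since the first components of [s] come from [phis], a [phi] already
    reproduced by [s] has its values in a sum of ranges where colinearity is known. *)
Lemma colinear_system (phis : seq dual) :
  exists s : seq (dual * {linear D -> Sigma}),
    (forall t, t \in s -> t.1 \in phis) /\
    forall phi, phi \in phis ->
      (forall x, residue s (qpure phi x) = 0) /\
      forall t, t \in s -> qend (t.2 \o qpure phi).
Proof.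
elim: phis => [|phi phis [s [s_sub IH]]]; first by exists [::].
have [r0|] := pselect (forall x, residue s (qpure phi x) = 0).
  exists s; split=> [t /s_sub|psi]; rewrite inE; first by move=> ->; rewrite orbT.
  case/predU1P=> [->|/IH//]; split=> // t ts; apply/colinear_atP => x.
  rewrite (residue0E (r0 x)) big_seq.
  elim/big_ind: _ => [|u v|t' t's]; [|exact: colinear_atD|].
    rewrite /colinear_at !linear0; apply: esym.
    by apply: additive0; apply: (tmap_rlD (rlin_linear t.2) (llin_id D)).
  by have [_ /(_ t ts)/colinear_atP h] := IH _ (s_sub _ t's); apply: h.
move=> /existsNP[x /eqP rx0].
(* Gram-Schmidt step: q retracts p(phi, -) and vanishes on the earlier p(psi, -),
   and adj makes the earlier retractions vanish on p(phi, -). *)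
have [q0 q0K] := @qretraction (residue s \o qpure phi) x rx0.
pose q : {linear D -> Sigma} := q0 \o residue s.
have q_phis psi y : psi \in phis -> q (qpure psi y) = 0.
  by move=> /IH[+ _] => /(_ y) /= ->; rewrite linear0.
have q_phi y : q (qpure phi y) = y by apply: q0K.
pose adj (q1 : {linear D -> Sigma}) : {linear D -> Sigma} :=
  q1 - (q1 \o qpure phi \o q : {linear D -> Sigma}).
have adjE q1 c : adj q1 c = q1 c - q1 (qpure phi (q c)) by [].
have [[hT _ _] _] := qend_division.
exists ((phi, q) :: [seq (t.1, adj t.2) | t <- s]); split=> [t|psi].
  rewrite !inE => /predU1P[->|/mapP[t' /s_sub t's ->]]; first by rewrite eqxx.
  by rewrite t's orbT.
rewrite inE => /predU1P psiP; split=> [y|t].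
  have S c : \sum_(t <- [seq (t.1, adj t.2) | t <- s]) qpure t.1 (t.2 c) =
      \sum_(t <- s) qpure t.1 (t.2 c - t.2 (qpure phi (q c))) by rewrite big_map.
  rewrite /residue /partial_id big_cons S.
  case: psiP => [->|psis].
    under eq_bigr do rewrite q_phi subrr linear0.
    by rewrite big1 // q_phi addr0 subrr.
  rewrite q_phis // linear0 add0r.
  under eq_bigr do rewrite (linear0 _) subr0.
  by have [+ _] := IH psi psis => /(_ y).
(* The four composites are the identity, zero, zero, and one already known to lie in [qend]. *)
rewrite inE => /predU1P[->|/mapP[t' t's ->]] /=; case: psiP => [->|psis].
- have -> : q \o qpure phi = 1 :> End by apply: linear_ext.
  exact: subring1.
- have -> : q \o qpure psi = 0 :> End by apply: linear_ext => y; apply: q_phis.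
  exact: qend0.
- have -> : adj t'.2 \o qpure phi = 0 :> End.
    by apply: linear_ext => y; rewrite -[LHS]/(adj _ _) adjE q_phi subrr.
  exact: qend0.
- have -> : adj t'.2 \o qpure psi = t'.2 \o qpure psi :> End.
    apply: linear_ext => y; rewrite -[LHS]/(adj _ _) adjE q_phis //.
    rewrite (linear0 (qpure phi)) (linear0 t'.2) subr0. exact: erefl.
  by have [_ ] := IH psi psis; apply.
Qed.

(** The second identity is the counit applied to the first. It expands each [phi] with coefficients
    in [qend], which can then be moved across a tensor sign. *)
Lemma qpure_decomp (phis : seq dual) :
  exists s : seq (dual * {linear D -> Sigma}), forall (phi : dual), phi \in phis ->
    [/\ forall x, qpure phi x = \sum_(t <- s) qpure t.1 (t.2 (qpure phi x)),
        phi = \sum_(t <- s) (t.1 \o (t.2 \o qpure phi : End) : dual)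
      & forall t, t \in s -> qend (t.2 \o qpure phi)].
Proof.
have [s [_ hs]] := colinear_system phis.
exists s => phi /hs[r0 hq]; have E x := residue0E (r0 x).
split=> //; apply: linear_ext => x.
rewrite -[LHS]counit_qpure {1}E linear_sum.
rewrite (additive_big _ _ _ (f := fun f : dual => f x)) //.
by apply: eq_bigr => t _; rewrite counit_qpure.
Qed.

(** Once the coefficients supplied by [qpure_decomp] are moved across the tensor sign, the image of
    [c] is the sum of the tensors of [t.1] with [t.2 (p c)], which vanishes with [p c]. *)
Lemma ker_qend (c : CB) : p c = 0 -> cmx_ker qend c.
Proof.
rewrite (tens_sum c); set w := trepr c; rewrite linear_sum => pc0.
have {}pc0 : \sum_(q <- w) qpure q.1 q.2 = 0 by exact: pc0.
have [s hs] := qpure_decomp (unzip1 w).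
have [_ BT] := qend_division.
rewrite /cmx_ker /= (additive_big _ _ _ (cmx_projD BT)).
pose tp (psi : dual) (y : Sigma) : cmx qend := tpure psi y.
have tpD psi : {morph tp psi : y z / y + z} by move=> y z; apply: tpureDr.
transitivity (\sum_(t <- s) tp t.1 (t.2 (\sum_(q <- w) qpure q.1 q.2))); last first.
  by rewrite pc0; apply: big1 => t _; rewrite linear0 (additive0 (tpD _)).
under [RHS]eq_bigr do rewrite linear_sum (additive_big _ _ _ (tpD _)).
rewrite exchange_big big_seq [RHS]big_seq; apply: eq_bigr => q qw.
rewrite cmx_projE //; have [_ E hq] := hs q.1 (map_f fst qw).
rewrite {1}E -/(tp _ _) (additive_big _ _ _ (f := fun f => tp f q.2)); last first.
  by move=> f g; apply: tpureDl.
rewrite big_seq [RHS]big_seq; apply: eq_bigr => t ts.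
exact: (cmxA t.1 (exist qend _ (hq t ts)) q.2).
Qed.

(** By [qendoP] the map [qpure] is balanced over [qend], so [p] factors through the tensor product
    over [qend]. *)
Lemma qend_ker (c : CB) : cmx_ker qend c -> p c = 0.
Proof.
rewrite /cmx_ker /= => c0.
have bal : balanced (@dual_end _ _ Sigma qend) (@end_act _ _ Sigma qend) qpure.
  by split=> [f g x|f x y|f [b hb] x]; rewrite ?qpureDl ?qpureD //; apply: ((qendoP b).1 hb).
have [_ BT] := qend_division.
have E : forall u : CB, tlift qpure (cmx_proj qend u : cmx qend) = p u.
  apply: (@cmx_eq K A Sigma B _
      (fun u => tlift qpure (cmx_proj qend u : cmx qend)) p) => [u v|u v|f x].
  - by rewrite cmx_projD // tliftD.
  - by rewrite linearD.
  - by rewrite cmx_projE // tliftE.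
by rewrite -E c0 tlift0.
Qed.

(** The decomposition reproduces [c] from the elements [t.2 c], so these cannot all vanish. *)
Lemma colinear_nonzero (c : D) : c <> 0 ->
  exists q : {linear D -> Sigma}, colinear_at q c /\ q c != 0.
Proof.
move=> c0; have [w Ew] := qpure_sum c; have [s hs] := qpure_decomp (unzip1 w).
have hc t : t \in s -> colinear_at t.2 c.
  move=> ts; rewrite Ew big_seq; elim/big_ind: _ => [|u v|q qw].
  - rewrite /colinear_at !linear0; apply: esym.
    by apply: additive0; apply: (tmap_rlD (rlin_linear t.2) (llin_id D)).
  - exact: colinear_atD.
  - by have [_ _ /(_ t ts)/colinear_atP h] := hs q.1 (map_f fst qw); apply: h.
have Ec : c = \sum_(t <- s) qpure t.1 (t.2 c).
  transitivity (\sum_(t <- s) \sum_(q <- w) qpure t.1 (t.2 (qpure q.1 q.2))); last first.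
    by apply: eq_bigr => t _; rewrite Ew (linear_sum t.2) (additive_big _ _ _ (@qpureD t.1)).
  rewrite {1}Ew exchange_big big_seq [RHS]big_seq; apply: eq_bigr => q qw /=.
  by have [E _ _] := hs q.1 (map_f fst qw).
case: (pselect (exists2 t, t \in s & t.2 c != 0)) => [[t ts tc]|nt].
  by exists t.2; split=> //; apply: hc.
case: c0; rewrite Ec big_seq big1 // => t ts; apply/eqP.
case: (eqVneq (t.2 c) 0) => [->|tc]; first by rewrite linear0.
by case: nt; exists t.
Qed.

(** A nonzero element of a sub-bicomodule yields a nonzero [x] in [Sigma] all of whose [qpure psi x]
    lie in the image. Such [x] form a submodule, which by simplicity is all of [Sigma]. *)
Lemma qcoring_simple : simple_coring D.
Proof.
split.
  (* If [D] were zero, [counit_qpure] would make all forms [e' i] vanish, and with them [Sigma]. *)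
  have [x x0] := simpleS.1; apply: contrapT => nd; apply: x0.
  rewrite (db_ract d x) big1 // => i _.
  have -> : e' i x = 0.
    rewrite -counit_qpure; case: (pselect (qpure (e' i) x = 0)) => [->|h].
      by rewrite linear0.
    by case: nd; exists (qpure (e' i) x).
  exact: scale0r.
move=> M i [_ hi] iinj; case: (pselect (forall m, i m = 0)); [by left|right].
move: b => /existsNP[m0 im0].
have [q [hq qm0]] := colinear_nonzero im0.
have Dqi := tmap_rlD (rlin_linear q) (llin_bimod i).
(* The preimage contracts the left coaction of [m0] with [psi \o q]. As [q] is colinear at [i m0],
   its image is the contraction by [psi] of the coaction of [q (i m0)]. *)
have img psi : exists m, i m = qpure psi (q (i m0)).
  exists (tlift (fun c m => lact (psi (q c) : A) m) (lcoact M m0)).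
  rewrite -qcoact_contract hq -[comul D _]/(lcoact (regbicomod D) (i m0)) hi.
  have bal := contract_balanced M (psi \o q : {linear D -> (A^c)^o}).
  have bal' := contract_balanced D psi.
  rewrite (tmap_comp _ (rlin_id _) (llin_bimod i) (rlin_linear q) (llin_id D)).
  apply: (@tens_fun_eq _ _ _ _ _ _
    (fun t => i (tlift (fun c m => lact ((psi \o q : {linear D -> (A^c)^o}) c : A) m) t))
    (fun t => tlift (fun y c => lact (psi y : A) c) (tmap q i t))) => [u v|u v|c m].
  - by rewrite tliftD // linearD.
  - by rewrite Dqi tliftD.
  - rewrite (tmap_rlE _ _ (rlin_linear q) (llin_bimod i)).
    by rewrite [in LHS]tliftE // [RHS]tliftE // bimod_funL.
pose U : set Sigma := [set x | forall psi, exists m, i m = qpure psi x]%classic.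
have [||UT] := @simple_op_submodule _ _ simpleS U.
- split; first by move=> psi; exists 0; rewrite !linear0.
  split=> [x y Ux Uy psi|a x Ux psi].
    have [[m im] [n jn]] := (Ux psi, Uy psi); exists (m - n).
    by rewrite !linearB im jn.
  by have [m im] := Ux psi; exists (a *: m); rewrite !linearZZ im.
- by move=> /(_ _ img) E; rewrite E eqxx in qm0.
apply: qpure_ind => [|u v [m <-] [n <-]|psi x]; last exact: UT.
  by exists 0; rewrite linear0.
by exists (m + n); rewrite linearD.
Qed.
End CoringQuotient.

(** * Colinear maps from functionals *)

Section Descent.
Variables (K : comPzRingType) (A : algType K) (Sigma : lmodType A^c).
Local Notation End := {linear Sigma -> Sigma}.
Local Notation dual := {linear Sigma -> (A^c)^o}.
Variables (d : dual_basis Sigma) (B : set End) (hB : is_subring B).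
Local Notation e := (db_vec d).
Local Notation e' := (db_form d).
Local Notation CB := (comatrix_coring d hB).
Variables (D : coring A) (p : coringHom CB D).
Hypothesis psurj : forall c, exists u, p u = c.
Hypothesis simpleS : simple_module Sigma.
Variable T : set End.
Hypotheses (divT : is_division_subring T) (BT : (B `<=` T)%classic).
Hypothesis ker_p : forall c : CB, p c = 0 <-> cmx_ker T c.

Lemma qpure_endT (phi : dual) (t : End) x : T t -> qpure p (phi \o t) x = qpure p phi (t x).
Proof.
move=> Tt; apply/eqP; rewrite -subr_eq0 /qpure -linearB; apply/eqP/ker_p.
rewrite /cmx_ker /= (additiveB (cmx_projD BT)) !cmx_projE //.
by apply/eqP; rewrite subr_eq0; apply/eqP; apply: (cmxA phi (exist T t Tt) x).
Qed.

Definition is_twist (l : functional T) (tw : D -> dual) :=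
  [/\ {morph tw : u v / u + v}, forall a c, tw (lact a c) = dual_lact a (tw c)
    & forall (phi : dual) x, tw (qpure p phi x) = (phi \o l x : dual)].

(** Left [T]-linearity of [l] makes [phi \o l x] balanced over [T]; the induced map descends to [D]
    because [ker_p] identifies the kernels. *)
Lemma twist_exists (l : functional T) : exists tw, is_twist l tw.
Proof.
pose f (phi : dual) x : dual := phi \o l x.
have bal : balanced (@dual_end _ _ Sigma T) (@end_act _ _ Sigma T) f.
  split=> [phi psi x|phi x y|phi [t Tt] x]; apply: linear_ext => z; rewrite /f //=.
    by rewrite functionalD -linearD.
  by rewrite (functionalM l _ Tt).
have [s sK] := choice psurj.
pose h (u : CB) : dual := tlift f (cmx_proj T u : cmx T).
have hD : {morph h : u v / u + v} by move=> u v; rewrite /h cmx_projD // tliftD.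
have hp u v : p u = p v -> h u = h v.
  move=> puv; apply/eqP; rewrite -subr_eq0 -(additiveB hD) /h; apply/eqP.
  have /ker_p -> : p (u - v) = 0 by rewrite linearB puv subrr.
  exact: tlift0.
have hE (phi : dual) x : h (tpure phi x : cmx B) = f phi x.
  by rewrite /h cmx_projE // tliftE.
have tD : {morph h \o s : u v / u + v}.
  by move=> u v /=; rewrite -hD; apply: hp; rewrite linearD !sK.
have tE (phi : dual) x : h (s (qpure p phi x)) = f phi x.
  by rewrite -hE; apply: hp; rewrite sK.
exists (h \o s); split=> // a.
apply: (qpure_eq psurj) => [u v|u v|phi x].
- by rewrite lactDr tD.
- rewrite tD; apply: linear_ext => y.
  exact: (@mulrDr A).
- by rewrite -qpure_lact /= !tE; apply: linear_ext.
Qed.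

Lemma functional_nontrivial : exists (l : functional T) x, l x = 1.
Proof.
have [x x0] := simpleS.1; have [l lx] := functional_exists divT x0.
by exists l, x.
Qed.

Lemma dual_separates (x y : Sigma) : (forall phi : dual, phi x = phi y) -> x = y.
Proof.
by move=> h; rewrite (db_ract d x) (db_ract d y); apply: eq_bigr => i _; rewrite h.
Qed.

Lemma qend_eq : qend p = T.
Proof.
apply/seteqP; split=> f; last by move=> Tf; apply/qendoP => phi x; apply: qpure_endT.
move=> /qendoP hf; have [l [x lx]] := functional_nontrivial.
have [tw [_ _ twE]] := twist_exists l.
suff -> : f = l (f x) by apply: functional_mem.
apply: linear_ext => y; apply: dual_separates => phi.
have := congr1 (fun g : dual => g y) (twE phi (f x)).
by rewrite -hf twE /= lx.
Qed.

Section Twisted.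
Variables (l : functional T) (tw : D -> dual) (htw : is_twist l tw).

Lemma twD : {morph tw : u v / u + v}. Proof. by case: htw. Qed.
Lemma twA a c : tw (lact a c) = dual_lact a (tw c). Proof. by case: htw. Qed.
Lemma twE (phi : dual) x : tw (qpure p phi x) = (phi \o l x : dual).
Proof. by case: htw. Qed.

Lemma tw_balanced (M : lmodType A^c) y : balanced (@ract _ _ M) (@lact _ _ D)
  (fun m c => ract m (tw c y : A)).
Proof.
split=> [m n c|m b c|m a c]; rewrite ?ractDl ?twD ?ractDr //.
by rewrite twA ractA.
Qed.

Definition tw_contract (y : Sigma) : tensAA D D -> D :=
  tlift (fun b c => ract b (tw c y : A)).

Lemma tw_contractD y : {morph tw_contract y : u v / u + v}.
Proof. by move=> u v; apply: tliftD; apply: tw_balanced. Qed.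

Lemma tw_contractE y b c : tw_contract y (tpure b c : tensA D D) = ract b (tw c y : A).
Proof. exact: (tliftE _ _ (tw_balanced D y)). Qed.

Lemma tw_contract_llin y : @llin _ _ (tensAA D D) D (tw_contract y).
Proof.
split=> [|a u]; first exact: tw_contractD.
apply: (@tensA_eq _ _ D D _ (fun u : tensAA D D => tw_contract y (lact a u))
   (fun u => lact a (tw_contract y u))) => [u' v|u' v|b c].
- by rewrite lactDr tw_contractD.
- by rewrite tw_contractD lactDr.
- by rewrite lact_tpure !tw_contractE lact_ract.
Qed.

(** On a generator [qpure phi x] both sides equal [qpure phi (l x y)]; on the right because [l x]
    lies in [T]. *)
Lemma tw_contract_comul y c : tw_contract y (comul D c) = qpure p (tw c) y.
Proof.
apply: (qpure_eq psurj (f := fun c => tw_contract y (comul D c))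
   (g := fun c => qpure p (tw c) y)) => [u v|u v|phi x].
- by rewrite linearD tw_contractD.
- by rewrite twD; apply: qpureDl.
rewrite comul_qpure qcoactE.
have hD := tmap_rlD (rlin_linear (qpure p phi)) (llin_id D).
rewrite (additive_big _ _ _ hD) (additive_big _ _ _ (@tw_contractD y)).
rewrite twE qpure_endT; last exact: functional_mem.
rewrite [in RHS](db_ract d (l x y)) (additive_big _ _ _ (@qpureD _ _ _ _ _ _ _ p phi)).
apply: eq_bigr => i _.
rewrite (tmap_rlE _ _ (rlin_linear (qpure p phi)) (llin_id D)) tw_contractE twE.
by rewrite -qpure_ract.
Qed.

Variable M : comodule D.

(* y |-> m_0 tw(m_1)(y) in Sweedler notation. *)
Definition tw_hom (m : M) (y : Sigma) : M :=
  tlift (fun n c => ract n (tw c y : A)) (coact M m).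

Lemma tw_hom_is_linear m : linear (tw_hom m).
Proof.
move=> a y z; rewrite /tw_hom /tlift scaler_sumr -big_split.
apply: eq_bigr => q _; rewrite linearP ractDr; congr (_ + _).
by rewrite -[RHS]/(ract _ a) ractA.
Qed.
HB.instance Definition _ m :=
  GRing.isLinear.Build A^c Sigma M *:%R (tw_hom m) (tw_hom_is_linear m).

(** Coassociativity turns the iterated coaction into a comultiplication, which [tw_contract_comul]
    evaluates. Expanding [tw c] in the dual basis then produces the coaction of [y]. *)
Lemma tw_hom_colinear m : @is_comod_map _ _ D (qcomod p) M (tw_hom m).
Proof.
move=> y; have hl := llin_bimod (comul D).
have hw := tw_contract_llin y.
have hwl : llin (qpure p^~ y \o tw : D -> D).
  by split=> [u v|a c] /=; rewrite ?twD ?qpureDl // twA qpure_lact.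
transitivity (tmap id (tw_contract y) (tassoc (tmap (coact M) id (coact M m)))).
  apply: esym; have hc := rlin_linear (coact M).
  have hT := tmap_rlD (rlin_id M) hw.
  rewrite /tw_hom.
  apply: (@tensA_eq _ _ M D _
     (fun t => tmap id (tw_contract y) (tassoc (tmap (coact M) id t)))
     (fun t => coact M (tlift (fun n c => ract n (tw c y : A)) t))) => [u v|u v|n c].
  - by rewrite (tmap_rlD hc (llin_id _)) tassocD hT.
  - by rewrite (tliftD _ _ (tw_balanced M y)) linearD.
  rewrite (tmap_rlE _ _ hc (llin_id _)) (tliftE _ _ (tw_balanced M y)) ract_lin.
  apply: (@tensA_eq _ _ M D _
     (fun t => tmap id (tw_contract y) (tassoc (tpure t c)))
     (fun t => ract t (tw c y : A))) => [u v|u v|n' c'].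
  - by rewrite tpureDl tassocD hT.
  - by rewrite ractDl.
  by rewrite tassocE (tmap_rlE _ _ (rlin_id _) hw) tw_contractE ract_tpure.
rewrite coactA (tmap_comp _ (rlin_id M) hl (rlin_id M) hw).
have -> : tw_contract y \o comul D = qpure p^~ y \o tw.
  by apply: funext => c; apply: tw_contract_comul.
rewrite qcoactE (additive_big _ _ _ (tmap_rlD (rlin_linear (tw_hom m)) (llin_id D))).
transitivity (\sum_i tpure (tw_hom m (e i)) (qpure p (e' i) y) : tensA M D); last first.
  by apply: eq_bigr => i _; rewrite (tmap_rlE _ _ (rlin_linear (tw_hom m)) (llin_id D)).
rewrite /tw_hom.
apply: (@tensA_eq _ _ M D _ (tmap id (qpure p^~ y \o tw)) (fun t => \sum_i
   tpure (tlift (fun n c => ract n (tw c (e i) : A)) t) (qpure p (e' i) y))) => [||n c].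
- exact: (tmap_rlD (rlin_id M) hwl).
- move=> u v; rewrite -big_split; apply: eq_bigr => i _ /=.
  by rewrite (tliftD _ _ (tw_balanced M _)); apply: tpureDl.
rewrite (tmap_rlE _ _ (rlin_id M) hwl) /= [in LHS](db_dual d (tw c)).
rewrite (additive_big _ _ _ (@qpureDl _ _ _ _ _ _ _ p y)).
rewrite (tpureA_sumr _ (fun i => qpure p (dual_lact (tw c (e i)) (e' i)) y)).
apply: eq_bigr => i _.
rewrite (tliftE _ _ (tw_balanced M _)) qpure_lact.
by apply: esym; apply: tpureA.
Qed.

End Twisted.

(** By the counit axiom [m] is a sum of terms [ract n (counit D c)]. A finite dual system rewrites
    each [counit D c] as a sum of values [tw c x], which reassemble into values of [tw_hom]. *)
Lemma qcomod_generates (M : comodule D) (m : M) :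
  exists s : seq (comodHom (qcomod p) M * Sigma), m = \sum_(q <- s) sval q.1 q.2.
Proof.
have [tw htw] := choice twist_exists.
have [W WE] := choice (qpure_sum psurj).
pose t := trepr (coact M m).
(* The vectors of [Sigma] occurring in chosen expansions of the [D]-components of the coaction of
   [m]. *)
have [s hs] := dual_system divT (flatten [seq unzip2 (W u.2) | u <- t]).
exists [seq (exist _ _ (tw_hom_colinear (htw q.1) m), q.2) | q <- s].
rewrite big_map /= -[LHS](coact1 m) /tlift exchange_big /=.
rewrite -/t big_seq [RHS]big_seq; apply: eq_bigr => u ut.
rewrite /ract -scaler_suml; congr (_ *: _).
rewrite {1}[u.2]WE linear_sum.
under [RHS]eq_bigr => q _.
  rewrite [u.2]WE (additive_big _ _ _ (twD (htw q.1))).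
  rewrite (additive_big _ _ _ (f := fun f : dual => f q.2)) //.
  over.
rewrite exchange_big big_seq [RHS]big_seq; apply: eq_bigr => w wu.
rewrite counit_qpure [w.2 in LHS]hs ?linear_sum; last first.
  by apply/flattenP; exists (unzip2 (W u.2)); [exact: map_f ut|exact: map_f].
by apply: eq_bigr => q _; rewrite (twE (htw q.1)).
Qed.

End Descent.

(** * Direct sums of copies of a simple module *)

Lemma sum_by_key (V : zmodType) (I J : eqType) (s : seq I) (k : I -> J) (F : I -> V) :
  \sum_(i <- s) F i = \sum_(j <- undup (map k s)) \sum_(i <- s | k i == j) F i.
Proof.
under [RHS]eq_bigr do rewrite big_mkcond.
rewrite exchange_big [LHS]big_seq [RHS]big_seq; apply: eq_bigr => i i_s.
rewrite (bigD1_seq (k i)) ?undup_uniq ?mem_undup ?map_f //= eqxx.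
by rewrite big1 ?addr0 // => j /negbTE; rewrite eq_sym => ->.
Qed.

Section IndependentFamilies.
Variables (R : pzRingType) (S M : lmodType R).
Hypothesis simpleS : simple_module S.
Local Notation Hom := {linear S -> M}.
Implicit Types (F H : set Hom) (s : seq (Hom * S)).

Definition supported F s := forall q, q \in s -> F q.1.
Definition combination s : M := \sum_(q <- s) q.1 q.2.
Definition spanned F m := exists s, supported F s /\ m = combination s.

(* A map may occur several times in s, so its coefficients are first collected. *)
Definition independent F := forall s, supported F s -> combination s = 0 ->
  forall f, \sum_(q <- s | q.1 == f) q.2 = 0.

Definition opp_list s := [seq (q.1, - q.2) | q <- s].

Lemma combination_cat s t : combination (s ++ t) = combination s + combination t.
Proof. exact: big_cat. Qed.
Lemma combination_opp s : combination (opp_list s) = - combination s.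
Proof.
rewrite /combination big_map -sumrN; apply: eq_bigr => q _ /=.
by rewrite linearN.
Qed.
Lemma supported_cat F s t : supported F s -> supported F t -> supported F (s ++ t).
Proof. by move=> hs ht q; rewrite mem_cat => /orP[/hs|/ht]. Qed.
Lemma supported_opp F s : supported F s -> supported F (opp_list s).
Proof. by move=> hs _ /mapP[q /hs Fq ->]. Qed.

Lemma spanned0 F : spanned F 0.
Proof. by exists [::]; split=> [q|]; rewrite ?/combination ?big_nil. Qed.
Lemma spannedD F m n : spanned F m -> spanned F n -> spanned F (m + n).
Proof.
move=> [s [hs ->]] [t [ht ->]]; exists (s ++ t).
by rewrite combination_cat; split=> //; apply: supported_cat.
Qed.
Lemma spannedN F m : spanned F m -> spanned F (- m).
Proof.
move=> [s [hs ->]]; exists (opp_list s).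
by rewrite combination_opp; split=> //; apply: supported_opp.
Qed.
Lemma spanned_scale F a m : spanned F m -> spanned F (a *: m).
Proof.
move=> [s [hs ->]]; exists [seq (q.1, a *: q.2) | q <- s]; split.
  by move=> _ /mapP[q /hs Fq ->].
rewrite /combination big_map scaler_sumr; apply: eq_bigr => q _ /=.
by rewrite linearZZ.
Qed.
Lemma spanned_mem F (f : Hom) y : F f -> spanned F (f y).
Proof.
move=> Ff; exists [:: (f, y)]; split=> [q|]; first by rewrite inE => /eqP ->.
by rewrite /combination big_seq1.
Qed.
(** In a vanishing combination the terms at [h] collect to [h y], which lies in the span of [F]. The
    hypothesis on [h] covers both its injectivity and the trivial intersection. *)
Lemma independent_add F (h : Hom) : independent F ->
  (forall y, spanned F (h y) -> y = 0) -> independent (F `|` [set h])%classic.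
Proof.
move=> indF hF s hs; rewrite /combination (bigID (fun q => q.1 == h)) /=.
set t := [seq q <- s | q.1 != h]; pose y := \sum_(q <- s | q.1 == h) q.2.
have ht : supported F t.
  by move=> q; rewrite mem_filter => /andP[qh /hs[//|/= E]]; rewrite E eqxx in qh.
have -> : \sum_(q <- s | q.1 == h) q.1 q.2 = h y.
  by rewrite linear_sum; apply: eq_bigr => q /eqP ->.
rewrite -big_filter -/t -/(combination t) => E.
have y0 : y = 0.
  apply: hF; exists (opp_list t); split; first exact: supported_opp.
  by rewrite combination_opp; apply/eqP; rewrite -addr_eq0 E.
move=> f; have [->//|fh] := eqVneq f h.
rewrite y0 linear0 add0r in E; have := indF t ht E f; rewrite big_filter_cond /=; apply: etrans.
apply: eq_bigl => q; case: (eqVneq q.1 f) => [->|]; last by rewrite andbF.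
by rewrite fh.
Qed.

(** For [h] in [H] the [y] with [h y] in the span form a submodule of the simple module [S]: if it
    is zero, [h] could be adjoined, against maximality. *)
Lemma maximal_independent H F0 : (F0 `<=` H)%classic -> independent F0 ->
  exists F, [/\ (F0 `<=` F)%classic, (F `<=` H)%classic, independent F
    & forall h, H h -> forall y, spanned F (h y)].
Proof.
(* [F0] is adjoined inside the predicate, so that the union of the empty chain satisfies it. *)
move=> F0H ind0; pose P X := (X `<=` H)%classic /\ independent (X `|` F0)%classic.
have P0 : P set0 by split=> //; rewrite set0U.
have [|X [[XH indX] Xmax]] := @Zorn_bigcup _ P.
  move=> C CP Ctot; split; first by move=> f [X /CP[XH _]]; apply: XH.
  move=> s hs; suff [X [[_ indX] hX]] : exists X, P X /\ supported (X `|` F0)%classic s.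
    exact: indX.
  (* A finite list is supported in one member of the chain; the empty set starts the induction even
     for an empty chain. *)
  suff [X [_ [PX hX]]] : exists X, (C X \/ X = set0) /\ P X /\ supported (X `|` F0)%classic s.
    by exists X.
  elim: s hs => [|q s IH] hs; first by exists set0; split; [right|split].
  have [|X [CX [PX hX]]] := IH; first by move=> r rs; apply: hs; rewrite inE rs orbT.
  have [|[Y CY Yq]|F0q] := hs q; first exact: mem_head.
    have PY := CP _ CY.
    have [XY|YX] : (X `<=` Y)%classic \/ (Y `<=` X)%classic.
      by case: CX => [CX|->]; [exact: Ctot|left].
      exists Y; split; [by left|split=> // r; rewrite inE => /predU1P[->|/hX[]]].
      - by left.
      - by move=> /XY; left.
      - by right.
    exists X; split=> //; split=> // r; rewrite inE => /predU1P[->|/hX//].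
    by left; apply: YX.
  exists X; split=> //; split=> // r; rewrite inE => /predU1P[->|/hX//].
  by right.
exists (X `|` F0)%classic; split=> [f|f [/XH|/F0H]||h Hh] //; first by right.
set F := (X `|` F0)%classic.
have [|h0|//] := @simple_op_submodule _ _ simpleS [set y | spanned F (h y)]%classic.
  split; first by rewrite /= linear0; apply: spanned0.
  split=> [y z hy hz|a y hy] /=; last by rewrite linearZZ; apply: spanned_scale.
  by rewrite linearB; apply: spannedD => //; apply: spannedN.
have [Fh|nFh] := pselect (F h); first by move=> y; apply: spanned_mem.
case: (Xmax (X `|` [set h])%classic).
  rewrite properEneq; split; last by left.
  by apply/eqP => E; apply: nFh; left; rewrite E; right.
split=> [f [/XH//|->//]|].
by rewrite setUAC; apply: independent_add.
Qed.

Variable W : lmodType R.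

(** The value on a combination replaces each [f] by [g f]; it is well defined because independence
    makes the collected coefficients of a vanishing combination zero. *)
Lemma independent_lift F (g : Hom -> {linear S -> W}) : independent F ->
  (forall m, spanned F m) ->
  exists h : {linear M -> W}, forall f y, F f -> h (f y) = g f y.
Proof.
move=> indF span; pose image s : W := \sum_(q <- s) g q.1 q.2.
have im0 s : supported F s -> combination s = 0 -> image s = 0.
  move=> hs /(indF _ hs) E.
  rewrite /image (sum_by_key _ fst) /= big1 // => f _.
  under eq_bigr => q /eqP -> do over.
  by rewrite -linear_sum E linear0.
have im_opp s : image (opp_list s) = - image s.
  by rewrite /image big_map -sumrN; apply: eq_bigr => q _ /=; rewrite linearN.
have im_eq s t : supported F s -> supported F t -> combination s = combination t ->
    image s = image t.
  move=> hs ht E; apply/eqP; rewrite -subr_eq0 -im_opp /image -big_cat; apply/eqP.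
  apply: im0; first by apply: supported_cat => //; apply: supported_opp.
  by rewrite combination_cat combination_opp E subrr.
have [c hc] := choice span.
have h_lin : linear (image \o c).
  move=> a u v /=; have [[[hu Eu] [hv Ev]] [huv Euv]] := (hc u, hc v, hc (a *: u + v)).
  transitivity (image ([seq (q.1, a *: q.2) | q <- c u] ++ c v)).
    apply: im_eq => //.
      apply: supported_cat => //; move=> _ /mapP[q /hu Fq ->] //.
    rewrite -Euv combination_cat -Ev {1}Eu; congr (_ + _).
    rewrite /combination big_map scaler_sumr; apply: eq_bigr => q _ /=.
    by rewrite linearZZ.
  rewrite /image big_cat big_map scaler_sumr; congr (_ + _).
  by apply: eq_bigr => q _ /=; rewrite linearZZ.
pose hL := GRing.isLinear.Build R M W *:%R (image \o c) h_lin.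
pose h : {linear M -> W} := HB.pack (image \o c) hL.
exists h => f y Ff; have [hfy Efy] := hc (f y).
rewrite -[LHS]/(image (c (f y))) (@im_eq _ [:: (f, y)]) //.
- by rewrite /image big_seq1.
- by move=> q; rewrite inE => /eqP ->.
- by rewrite -Efy /combination big_seq1.
Qed.

End IndependentFamilies.

(** * Comodules *)

Section ComoduleConstructions.
Variables (K : comPzRingType) (A : algType K) (D : coring A).
Implicit Types M N : comodule D.

(** The comodule axioms at one element, so that they can be verified on images of comodules and on
    sums of such elements. *)
Definition coaction_at (X : lmodType A^c) (c : {linear X -> tensA X D}) (x : X) : Prop :=
  tassoc (tmap c id (c x)) = tmap id (comul D) (c x) /\
  tlift (fun y b => ract y (counit D b)) (c x) = x.

Lemma counit_balanced (X : lmodType A^c) : balanced (@ract _ _ X) (@lact _ _ D)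
  (fun x b => ract x (counit D b)).
Proof.
split=> [x y b|x b c|x a b]; rewrite ?ractDl ?linearD ?ractDr //.
by rewrite bimod_funL ractA.
Qed.

Lemma coaction_atD (X : lmodType A^c) (c : {linear X -> tensA X D}) x y :
  coaction_at c x -> coaction_at c y -> coaction_at c (x + y).
Proof.
move=> [hx1 hx2] [hy1 hy2]; split; rewrite linearD.
  rewrite (tmap_rlD (rlin_linear c) (llin_id D)) tassocD hx1 hy1.
  by rewrite (tmap_rlD (rlin_id X) (llin_bimod (comul D))).
by rewrite (tliftD _ _ (@counit_balanced X)) hx2 hy2.
Qed.

Lemma coaction_at_image M (X : lmodType A^c) (c : {linear X -> tensA X D})
    (u : {linear M -> X}) m :
  (forall n, c (u n) = tmap u id (coact M n)) -> coaction_at c (u m).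
Proof.
move=> cu; have hu := rlin_linear u; have hc := rlin_linear c.
have hm := rlin_linear (coact M); have hi := llin_id D.
have hl := llin_bimod (comul D).
split; rewrite cu.
  rewrite (tmap_comp _ hu hi hc hi).
  have -> : c \o u = tmap u (@id D) \o coact M by apply: funext => n; apply: cu.
  have ri := rlin_tmap hu hi (rlin_id D).
  rewrite -[LHS]/(tassoc (tmap (tmap u (@id D) \o coact M) (@id D \o @id D) (coact M m))).
  rewrite -(tmap_comp _ hm hi ri hi) (tassoc_nat _ hu hi (rlin_id D) hi) coactA.
  have E : (tmap id id : tensAA D D -> tensAA D D) = id.
    apply: funext; apply: tensA_eq => // [|b b'].
      exact: (tmap_rlD (rlin_id D) hi).
    by rewrite (tmap_rlE _ _ (rlin_id D) hi).
  rewrite E (tmap_comp _ (rlin_id M) hl hu (llin_id _)).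
  by rewrite (tmap_comp _ hu hi (rlin_id X) hl).
transitivity (u (tlift (fun n b => ract n (counit D b)) (coact M m))); last by rewrite coact1.
apply: (@tensA_eq _ _ M D _
   (fun t => tlift (fun y b => ract y (counit D b)) (tmap u id t))
   (fun t => u (tlift (fun n b => ract n (counit D b)) t))) => [v w|v w|n b].
- by rewrite (tmap_rlD hu hi) (tliftD _ _ (@counit_balanced X)).
- by rewrite (tliftD _ _ (@counit_balanced M)) linearD.
rewrite (tmap_rlE _ _ hu hi) (tliftE _ _ (@counit_balanced X)).
by rewrite (tliftE _ _ (@counit_balanced M)) ract_lin.
Qed.

Lemma is_comod_map0 M N : is_comod_map (0 : {linear M -> N}).
Proof.
move=> m; rewrite linear0; apply: (@tensA_eq _ _ M D _ (fun=> 0) (tmap _ id)).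
- by move=> x y; rewrite addr0.
- exact: (tmap_rlD (rlin_linear (0 : {linear M -> N})) (llin_id D)).
move=> x b; rewrite (tmap_rlE _ _ (rlin_linear (0 : {linear M -> N})) (llin_id D)).
by rewrite (additive0 (f := fun y => tpure y b : tensA N D)) // => u v; apply: tpureDl.
Qed.

Lemma is_comod_mapB M N (f g : {linear M -> N}) :
  is_comod_map f -> is_comod_map g -> is_comod_map (f - g).
Proof.
move=> hf hg m; rewrite -[(f - g) m]/(f m - g m) linearB hf hg.
have [Df Dg] := (tmap_rlD (rlin_linear f) (llin_id D), tmap_rlD (rlin_linear g) (llin_id D)).
apply: (@tensA_eq _ _ M D _ (fun t => tmap f id t - tmap g id t) (tmap (f - g) id)).
- by move=> u v; rewrite Df Dg opprD addrACA.
- exact: (tmap_rlD (rlin_linear (f - g)) (llin_id D)).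
move=> x b; rewrite (tmap_rlE _ _ (rlin_linear (f - g)) (llin_id D)).
rewrite (tmap_rlE _ _ (rlin_linear f) (llin_id D)) (tmap_rlE _ _ (rlin_linear g) (llin_id D)).
by rewrite (additiveB (f := fun y => tpure y b : tensA N D)) // => u v; apply: tpureDl.
Qed.

Definition comodHom0 M N : comodHom M N := exist _ _ (@is_comod_map0 M N).
Definition comodHomB M N (f g : comodHom M N) : comodHom M N :=
  exist _ _ (is_comod_mapB (svalP f) (svalP g)).

(** Reduces colinearity of [f] to composites with comodule maps whose images generate. *)
Lemma is_comod_map_pre M N P (f : {linear M -> N}) (g : comodHom P M) y :
  is_comod_map (f \o sval g : {linear P -> N}) ->
  coact N (f (sval g y)) = tmap f id (coact M (sval g y)).
Proof.
move=> fg; rewrite (svalP g).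
by rewrite (tmap_comp _ (rlin_linear (sval g)) (llin_id D) (rlin_linear f) (llin_id D)) -fg.
Qed.

(** * Splitting of idempotent comodule endomorphisms *)

Section FixedPoints.
Variables (M : comodule D) (f : comodHom M M).
Hypothesis ff : forall x, sval f (sval f x) = sval f x.

Definition fixed_pred : {pred M} := fun x => sval f x == x.
Lemma fixed_submod_closed : submod_closed fixed_pred.
Proof.
split; first by rewrite unfold_in linear0.
by move=> a x y; rewrite !unfold_in linearP => /eqP -> /eqP ->.
Qed.
HB.instance Definition _ := GRing.isSubmodClosed.Build A^c M fixed_pred fixed_submod_closed.

Record fixed := Fixed { fixed_val : M; fixedP : fixed_val \in fixed_pred }.
HB.instance Definition _ := [isSub for fixed_val].
HB.instance Definition _ := [Choice of fixed by <:].
HB.instance Definition _ := [SubChoice_isSubLmodule of fixed by <:].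

Lemma fixed_mem x : sval f x \in fixed_pred.
Proof. by rewrite unfold_in ff. Qed.

Definition fixed_proj (x : M) : fixed := Fixed (fixed_mem x).
Lemma fixed_proj_is_linear : linear fixed_proj.
Proof. by move=> a x y; apply: val_inj; exact: (linearP (sval f)). Qed.
HB.instance Definition _ :=
  GRing.isLinear.Build A^c M fixed *:%R fixed_proj fixed_proj_is_linear.

Lemma fixed_projK x : fixed_proj (val x) = x.
Proof. by apply: val_inj => /=; apply/eqP; apply: fixedP. Qed.

(** The coaction of [M] is pushed along the projection, since its restriction to [fixed] only takes
    values in [tensA M D]. *)
Definition fixed_coact (x : fixed) : tensA fixed D := tmap fixed_proj id (coact M (val x)).
Lemma fixed_coact_is_linear : linear fixed_coact.
Proof.
have [hD hA] := rlin_tmap (rlin_linear fixed_proj) (llin_id D) (rlin_id D).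
move=> a x y; rewrite /fixed_coact -[val _]/(a *: val x + val y) linearP hD.
by congr (_ + _); apply: hA.
Qed.
HB.instance Definition _ :=
  GRing.isLinear.Build A^c fixed (tensA fixed D) *:%R fixed_coact fixed_coact_is_linear.

Lemma fixed_coact_proj x : fixed_coact (fixed_proj x) = tmap fixed_proj id (coact M x).
Proof.
rewrite /fixed_coact /= (svalP f).
rewrite (tmap_comp _ (rlin_linear (sval f)) (llin_id D) (rlin_linear fixed_proj) (llin_id D)).
by congr (tmap _ _ _); apply: funext => y; apply: val_inj; rewrite /= ff.
Qed.

Lemma fixed_coaction x : coaction_at fixed_coact x.
Proof. by rewrite -[x]fixed_projK; apply: coaction_at_image; apply: fixed_coact_proj. Qed.

Definition fixed_comod : comodule D := @Comodule _ _ D fixed fixed_coact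
  (fun x => (fixed_coaction x).1) (fun x => (fixed_coaction x).2).

Lemma fixed_val_comod_map : @is_comod_map _ _ D fixed_comod M (val : {linear fixed -> M}).
Proof.
move=> x; rewrite -[RHS]/(tmap val id (tmap fixed_proj id (coact M (val x)))).
rewrite (tmap_comp _ (rlin_linear fixed_proj) (llin_id D)
  (rlin_linear (val : {linear fixed -> M})) (llin_id D)).
by have /eqP E := fixedP x; rewrite -[LHS]/(coact M (fixed_val x)) -{1}E (svalP f).
Qed.

Lemma split_idempotent : exists (X : comodule D) (i : comodHom X M) (r : comodHom M X),
  (forall x, sval i (sval r x) = sval f x) /\ (forall x, sval r (sval i x) = x).
Proof.
exists fixed_comod, (exist _ _ fixed_val_comod_map).
exists (exist _ (fixed_proj : {linear M -> fixed_comod}) fixed_coact_proj).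
by split=> // x; apply: fixed_projK.
Qed.

End FixedPoints.

(** * Binary direct sums of comodules *)

Section DirectSum.
Variables M N : comodule D.

Definition dsum_inl (x : M) : (M * N)%type := (x, 0).
Definition dsum_inr (y : N) : (M * N)%type := (0, y).
Lemma dsum_inl_is_linear : linear dsum_inl.
Proof. by move=> a x y; apply: injective_projections; rewrite /= ?scaler0 ?addr0. Qed.
Lemma dsum_inr_is_linear : linear dsum_inr.
Proof. by move=> a x y; apply: injective_projections; rewrite /= ?scaler0 ?addr0. Qed.
HB.instance Definition _ :=
  GRing.isLinear.Build A^c M (M * N)%type *:%R dsum_inl dsum_inl_is_linear.
HB.instance Definition _ :=
  GRing.isLinear.Build A^c N (M * N)%type *:%R dsum_inr dsum_inr_is_linear.

Lemma dsumE (z : M * N) : z = dsum_inl z.1 + dsum_inr z.2.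
Proof. by case: z => x y; apply: injective_projections; rewrite /= ?addr0 ?add0r. Qed.

Definition dsum_coact (z : (M * N)%type) : tensA (M * N)%type D :=
  tmap dsum_inl id (coact M z.1) + tmap dsum_inr id (coact N z.2).
Lemma dsum_coact_is_linear : linear dsum_coact.
Proof.
have [lD lA] := rlin_tmap (rlin_linear dsum_inl) (llin_id D) (rlin_id D).
have [rD rA] := rlin_tmap (rlin_linear dsum_inr) (llin_id D) (rlin_id D).
move=> a x y; rewrite /dsum_coact !linearP lD rD scalerDr addrACA.
by congr (_ + _ + _); [apply: lA|apply: rA].
Qed.
HB.instance Definition _ := GRing.isLinear.Build A^c (M * N)%type (tensA (M * N)%type D) *:%R
  dsum_coact dsum_coact_is_linear.

Lemma dsum_coact_inl x : dsum_coact (dsum_inl x) = tmap dsum_inl id (coact M x).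
Proof.
rewrite /dsum_coact /= linear0 (additive0 (f := tmap dsum_inr (@id D))) ?addr0 //.
exact: (tmap_rlD (rlin_linear dsum_inr) (llin_id D)).
Qed.
Lemma dsum_coact_inr y : dsum_coact (dsum_inr y) = tmap dsum_inr id (coact N y).
Proof.
rewrite /dsum_coact /= linear0 (additive0 (f := tmap dsum_inl (@id D))) ?add0r //.
exact: (tmap_rlD (rlin_linear dsum_inl) (llin_id D)).
Qed.

Lemma dsum_coaction z : coaction_at dsum_coact z.
Proof.
rewrite [z]dsumE; apply: coaction_atD; apply: coaction_at_image.
  exact: dsum_coact_inl.
exact: dsum_coact_inr.
Qed.

Definition dsum_comod : comodule D := @Comodule _ _ D (M * N)%type dsum_coact
  (fun z => (dsum_coaction z).1) (fun z => (dsum_coaction z).2).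

Definition dsum_inlH : comodHom M dsum_comod :=
  exist _ (dsum_inl : {linear M -> dsum_comod}) dsum_coact_inl.
Definition dsum_inrH : comodHom N dsum_comod :=
  exist _ (dsum_inr : {linear N -> dsum_comod}) dsum_coact_inr.

Lemma dsum_map_colinear (P : comodule D) (h : {linear dsum_comod -> P}) :
  is_comod_map (h \o dsum_inl : {linear M -> P}) ->
  is_comod_map (h \o dsum_inr : {linear N -> P}) -> is_comod_map h.
Proof.
move=> hl hr z; have hD := tmap_rlD (rlin_linear h) (llin_id D).
rewrite [z]dsumE -[LHS]/(coact P (h (sval dsum_inlH z.1 + sval dsum_inrH z.2))).
rewrite linearD linearD (is_comod_map_pre (g := dsum_inlH)) //.
by rewrite (is_comod_map_pre (g := dsum_inrH)) // -hD -linearD.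
Qed.

End DirectSum.

End ComoduleConstructions.

(** * Corings whose comodules are generated by one comodule that is simple as a module *)

Section Cosemisimplicity.
Variables (K : comPzRingType) (A : algType K) (D : coring A) (S : comodule D).
Hypothesis simpleS : simple_module S.
Hypothesis S_generates : forall (M : comodule D) (m : M),
  exists s : seq (comodHom S M * S), m = \sum_(q <- s) sval q.1 q.2.
Local Notation Cat := (comod_category D).
Implicit Types M N : comodule D.

Definition colinear_maps M : set {linear S -> M} :=
  [set f | @is_comod_map _ _ D S M f]%classic.

Lemma spanned_colinear M (F : set {linear S -> M}) :
  (forall f, colinear_maps f -> forall y, spanned F (f y)) -> forall m, spanned F m.
Proof.
move=> h m; have [s ->] := S_generates m; elim: s => [|q s IH].
  by rewrite big_nil; apply: spanned0.
by rewrite big_cons; apply: spannedD => //; apply: h; apply: (svalP q.1).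
Qed.

Lemma basis_extend M (F0 : set {linear S -> M}) :
  (F0 `<=` @colinear_maps M)%classic -> independent F0 ->
  exists F, [/\ (F0 `<=` F)%classic, (F `<=` @colinear_maps M)%classic,
    independent F & forall m, spanned F m].
Proof.
move=> F0c /(maximal_independent simpleS F0c)[F [F0F Fc indF hF]].
by exists F; split=> //; apply: spanned_colinear.
Qed.

Lemma independent0 M : independent (set0 : set {linear S -> M}).
Proof.
by case=> [|q s] hs _ f; [rewrite big_nil|case: (hs q (mem_head _ _))].
Qed.

Lemma comodHom_eq_on M N (F : set {linear S -> M}) (g h : comodHom M N) :
  (forall m, spanned F m) -> (forall f y, F f -> sval g (f y) = sval h (f y)) -> g = h.
Proof.
move=> span gh; apply: comodHom_ext => m; have [s [hs ->]] := span m.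
rewrite /combination !linear_sum big_seq [RHS]big_seq.
by apply: eq_bigr => q /hs; apply: gh.
Qed.

Lemma basis_lift M N (F : set {linear S -> M}) (g : {linear S -> M} -> comodHom S N) :
  (F `<=` @colinear_maps M)%classic -> independent F -> (forall m, spanned F m) ->
  exists h : comodHom M N, forall f y, F f -> sval h (f y) = sval (g f) y.
Proof.
move=> Fc indF span; have [h hE] := independent_lift (sval \o g) indF span.
suff hc : is_comod_map h by exists (exist _ h hc).
move=> m; have [s [hs ->]] := span m.
have hD := tmap_rlD (rlin_linear h) (llin_id D).
rewrite /combination !linear_sum (additive_big _ _ _ hD) big_seq [RHS]big_seq.
apply: eq_bigr => q /hs Fq.
rewrite -[RHS](@is_comod_map_pre _ _ D M N S h (exist _ q.1 (Fc _ Fq)) q.2) // => y.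
by rewrite -[LHS]/(coact N (h (q.1 y))) hE // (svalP (g q.1)); congr (tmap _ _ _);
  apply: funext => z /=; rewrite hE.
Qed.

(** [F1] is a basis of the image of [f] made of composites with [f]. It extends to a basis of [N],
    on which [g] sends each element of [F1] to a chosen lift. *)
Lemma comodHom_regular M N (f : comodHom M N) :
  exists g : comodHom N M, forall x, sval f (sval g (sval f x)) = sval f x.
Proof.
pose H : set {linear S -> N} :=
  [set h | exists2 a, @colinear_maps M a & h = sval f \o a :> {linear S -> N}]%classic.
have Hc : (H `<=` @colinear_maps N)%classic.
  by move=> _ [a ha ->]; apply: (svalP (comod_comp f (exist _ a ha))).
have [F1 [_ F1H ind1 span1]] :=
  maximal_independent simpleS (sub0set H) (@independent0 N).
have [F [F1F Fc indF spanF]] := basis_extend (subset_trans F1H Hc) ind1.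
(* Basis elements outside [F1] get the default value zero. *)
have liftex (h : {linear S -> N}) : exists a : comodHom S M,
    F1 h -> h = sval f \o sval a :> {linear S -> N}.
  have [/F1H[a ha E]|nh] := pselect (F1 h); last by exists (comodHom0 S M).
  by exists (exist _ a ha).
have [g gE] := choice liftex.
have [k kE] := basis_lift g Fc indF spanF.
have fk1 n : spanned F1 n -> sval f (sval k n) = n.
  move=> [s [hs ->]]; rewrite /combination !linear_sum big_seq [RHS]big_seq.
  apply: eq_bigr => q /hs Fq; rewrite kE; last exact: F1F.
  exact: (esym (congr1 (fun h : {linear S -> N} => h q.2) (gE _ Fq))).
exists k => x; apply: fk1; have [s ->] := S_generates x.
elim: s => [|q s IH]; first by rewrite big_nil linear0; apply: spanned0.
rewrite big_cons linearD; apply: spannedD => //.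
by apply: (span1 (sval f \o sval q.1)); exists (sval q.1) => //; apply: (svalP q.1).
Qed.

(** * Zero objects, kernels, cokernels, products and coproducts of comodules *)

Lemma zero_objP (Z : Cat) : zero_obj Z <-> forall z : (Z : comodule D), z = 0.
Proof.
split=> [[hZ _] z|Z0].
  have [f [_ fU]] := hZ Z.
  have /(congr1 (fun g : comodHom Z Z => sval g z)) := fU (comod_id Z) I.
  by rewrite (fU (comodHom0 Z Z) I).
split=> X.
  exists (comodHom0 (Z : comodule D) X); split=> // g _; apply: comodHom_ext => z.
  by rewrite (Z0 z) !linear0.
exists (comodHom0 X (Z : comodule D)); split=> // g _; apply: comodHom_ext => x.
by rewrite [RHS]Z0 [LHS]Z0.
Qed.

Lemma comod_zero_obj_exists : exists Z : Cat, zero_obj Z.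
Proof.
have [|Z [i [r [ir ri]]]] := @split_idempotent _ _ D S (comodHom0 S S).
  by move=> x; rewrite linear0.
by exists Z; apply/zero_objP => z; rewrite -(ri z) -(ri (sval r _)) ir linear0.
Qed.

Lemma zero_morP (X Y : Cat) (f : mor X Y) :
  zero_mor f <-> forall x, sval (f : comodHom X Y) x = 0.
Proof.
split=> [[Z [g [h [/zero_objP Z0 ->]]]] x|f0].
  by rewrite /= (Z0 (sval (h : comodHom X Z) x)) linear0.
have [Z hZ] := comod_zero_obj_exists.
exists Z, (comodHom0 (Z : comodule D) Y), (comodHom0 X (Z : comodule D)); split=> //.
by apply: comodHom_ext => x; rewrite f0.
Qed.

Lemma comod_kernel_exists (X Y : Cat) (f : mor X Y) :
  exists W (k : mor W X), is_kernel k f.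
Proof.
have [g fgf] := comodHom_regular f.
pose c : comodHom X X := comodHomB (comod_id X) (comod_comp g f).
have cE x : sval c x = x - sval g (sval (f : comodHom X Y) x) by [].
have fc x : sval (f : comodHom X Y) (sval c x) = 0 by rewrite cE linearB fgf subrr.
have [|W [i [r [ir ri]]]] := @split_idempotent _ _ D X c.
  by move=> x; rewrite cE fc linear0 subr0.
exists W, i; split; first by apply/zero_morP => w; rewrite /= -(ri w) ir fc.
move=> V u /zero_morP fu; exists (comod_comp r u); split=> [|h <-].
  by apply: comodHom_ext => v /=; rewrite ir cE [sval f _]fu linear0 subr0.
by apply: comodHom_ext => v /=; rewrite ri.
Qed.

Lemma comod_cokernel_exists (X Y : Cat) (f : mor X Y) :
  exists W (q : mor Y W), is_cokernel f q.
Proof.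
have [g fgf] := comodHom_regular f.
pose c : comodHom Y Y := comodHomB (comod_id Y) (comod_comp f g).
have cE y : sval c y = y - sval (f : comodHom X Y) (sval g y) by [].
have cf x : sval c (sval (f : comodHom X Y) x) = 0 by rewrite cE fgf subrr.
have [|W [i [r [ir ri]]]] := @split_idempotent _ _ D Y c.
  by move=> y; rewrite -[RHS]subr0 -(cf (sval g y)) -linearB.
exists W, r; split.
  by apply/zero_morP => x; rewrite /= -(ri (sval r _)) ir cf linear0.
move=> V u /zero_morP uf; exists (comod_comp u i); split=> [|h <-].
  by apply: comodHom_ext => y /=; rewrite ir cE linearB [X in _ - X]uf subr0.
by apply: comodHom_ext => w /=; rewrite ri.
Qed.

(** Cancelling [f] in [f g f = f] gives [g f = 1], and [f] is then the kernel of [1 - f g]. *)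
Lemma comod_mono_is_kernel (X Y : Cat) (f : mor X Y) : is_mono f ->
  exists Z (g : mor Y Z), is_kernel f g.
Proof.
move=> fmono; have [g fgf] := comodHom_regular f.
have gf : comod_comp g f = comod_id X.
  by apply: fmono; apply: comodHom_ext => x; apply: fgf.
have gfE x : sval g (sval (f : comodHom X Y) x) = x.
  exact: (congr1 (fun h : comodHom X X => sval h x) gf).
exists Y, (comodHomB (comod_id Y) (comod_comp f g)); split.
  by apply/zero_morP => x; rewrite -[LHS]/(_ - sval f (sval g (sval f x))) gfE subrr.
move=> V u /zero_morP hu; exists (comod_comp g u); split=> [|h <-].
  apply: comodHom_ext => v; apply/esym/eqP; rewrite -subr_eq0; apply/eqP; exact: hu.
by apply: comodHom_ext => v /=; rewrite gfE.
Qed.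

(** Dually [f g = 1], and [f] is the cokernel of [1 - g f]. *)
Lemma comod_epi_is_cokernel (X Y : Cat) (f : mor X Y) : is_epi f ->
  exists Z (g : mor Z X), is_cokernel g f.
Proof.
move=> fepi; have [g fgf] := comodHom_regular f.
have fg : comod_comp f g = comod_id Y.
  by apply: fepi; apply: comodHom_ext => x; apply: fgf.
have fgE y : sval (f : comodHom X Y) (sval g y) = y.
  exact: (congr1 (fun h : comodHom Y Y => sval h y) fg).
exists X, (comodHomB (comod_id X) (comod_comp g f)); split.
  apply/zero_morP => x; rewrite -[LHS]/(sval f (x - sval g (sval f x))).
  by rewrite linearB fgE subrr.
move=> V u /zero_morP hu; exists (comod_comp u g); split=> [|h <-].
  apply: comodHom_ext => x; apply/esym/eqP; rewrite -subr_eq0; apply/eqP.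
  by rewrite -[RHS](hu x) -[RHS]/(sval u (x - sval g (sval f x))) linearB.
by apply: comodHom_ext => y /=; rewrite fgE.
Qed.

Lemma product_exists (X Y : Cat) :
  exists P (p : mor P X) (q : mor P Y), is_product p q.
Proof.
pose P : comodule D := dsum_comod X Y.
pose pl : {linear P -> (X : comodule D)} := (fst : {linear (X * Y)%type -> X}).
pose pr : {linear P -> (Y : comodule D)} := (snd : {linear (X * Y)%type -> Y}).
have plc : is_comod_map pl.
  apply: dsum_map_colinear => z.
    rewrite -[LHS]/(coact X z); exact: (svalP (comod_id X)).
  by rewrite -[LHS]/(coact X 0) linear0; have := @is_comod_map0 _ _ D Y X z; rewrite linear0.
have prc : is_comod_map pr.
  apply: dsum_map_colinear => z; last first.
    rewrite -[LHS]/(coact Y z); exact: (svalP (comod_id Y)).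
  by rewrite -[LHS]/(coact Y 0) linear0; have := @is_comod_map0 _ _ D X Y z; rewrite linear0.
exists (P : Cat), (exist _ pl plc : comodHom P X), (exist _ pr prc : comodHom P Y) => W f g.
(* The sum of the two composites, written with differences as [a - (0 - b)]. *)
exists (comodHomB (comod_comp (dsum_inlH (X : comodule D) (Y : comodule D)) f)
  (comodHomB (comodHom0 W P) (comod_comp (dsum_inrH (X : comodule D) (Y : comodule D)) g))).
have hE w : sval (comodHomB (comod_comp (dsum_inlH (X : comodule D) (Y : comodule D)) f)
    (comodHomB (comodHom0 W P) (comod_comp (dsum_inrH (X : comodule D) (Y : comodule D)) g))) w =
    (sval (f : comodHom W X) w, sval (g : comodHom W Y) w).
  by apply: injective_projections; rewrite /= ?subr0 ?sub0r ?opprK ?oppr0 ?addr0.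
split=> [|h [hf hg]].
  split; apply: comodHom_ext => w.
    exact: (congr1 fst (hE w)).
  exact: (congr1 snd (hE w)).
apply: comodHom_ext => w; apply: etrans (hE w) _; rewrite -hf -hg /=.
by case: (sval h w).
Qed.

Lemma coproduct_exists (X Y : Cat) :
  exists P (i : forall b : bool, mor (if b then X else Y) P), is_coproduct i.
Proof.
pose P : comodule D := dsum_comod X Y.
exists (P : Cat), (fun b => if b as b return comodHom (if b then X else Y) P
  then dsum_inlH (X : comodule D) (Y : comodule D)
  else dsum_inrH (X : comodule D) (Y : comodule D)) => W f.
pose fl : comodHom X W := f true; pose fr : comodHom Y W := f false.
pose h (z : P) : (W : comodule D) := sval fl z.1 + sval fr z.2.
have h_lin : linear h.
  by move=> a u v; rewrite /h !linearP scalerDr addrACA.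
pose hL := GRing.isLinear.Build A^c P W *:%R h h_lin.
pose H : {linear P -> (W : comodule D)} := HB.pack h hL.
have Hl x : H (dsum_inl Y x) = sval fl x by rewrite -[LHS]/(h _) /h /= linear0 addr0.
have Hr y : H (dsum_inr X y) = sval fr y by rewrite -[LHS]/(h _) /h /= linear0 add0r.
have Hc : is_comod_map H.
  apply: dsum_map_colinear => z.
    rewrite -[LHS]/(coact W (H (dsum_inl Y z))) Hl (svalP fl).
    by congr (tmap _ _ _); apply: funext => x; rewrite /= -Hl.
  rewrite -[LHS]/(coact W (H (dsum_inr X z))) Hr (svalP fr).
  by congr (tmap _ _ _); apply: funext => x; rewrite /= -Hr.
exists (exist _ H Hc); split=> [[]|k hk]; try by apply: comodHom_ext.
apply: comodHom_ext => z.
rewrite [z]dsumE linearD linearD -[X in X + _ = _]/(H (dsum_inl Y z.1)).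
rewrite -[X in _ + X = _]/(H (dsum_inr X z.2)) Hl Hr /fl /fr -(hk true) -(hk false).
by [].
Qed.

Lemma comod_category_abelian : abelian_category Cat.
Proof.
split.
- exact: comod_zero_obj_exists.
- exact: product_exists.
- exact: coproduct_exists.
- by split; [exact: comod_kernel_exists|exact: comod_cokernel_exists].
- by split; [exact: comod_mono_is_kernel|exact: comod_epi_is_cokernel].
Qed.

Lemma comod_endo_unit (f : comodHom S S) : sval f != 0 ->
  exists g : comodHom S S, comod_comp f g = comod_id S.
Proof.
move=> /(simple_endo_unit simpleS)[g [fg gf]].
have fgE x : sval f (g x) = x by rewrite -linend_mulE fg.
suff gc : is_comod_map g by exists (exist _ g gc); apply: comodHom_ext.
move=> x; rewrite -[in RHS](fgE x) (svalP f).
rewrite (tmap_comp _ (rlin_linear (sval f)) (llin_id D) (rlin_linear g) (llin_id D)).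
have -> : g \o sval f = idfun by apply: funext => y; rewrite -[LHS]/((g * sval f) y) gf.
exact: (comod_id_subproof (M := S) (g x)).
Qed.

(** A nonzero monomorphism [f] into [S] has a nonzero composite with some map from [S]; by Schur's
    lemma the composite is invertible, so [f] is a split epimorphism as well as mono. *)
Lemma generator_simple : @simple_obj Cat S.
Proof.
split; first by move=> /zero_objP S0; have [x x0] := simpleS.1; apply: x0.
move=> Y f fmono; have [f0|] := pselect (forall y, sval (f : comodHom Y S) y = 0).
  by left; apply/zero_morP.
move=> /existsNP[y fy]; right.
have [a fa] : exists a : comodHom S Y, sval (comod_comp (f : comodHom Y S) a) != 0.
  apply: contrapT => na; apply: fy; have [s ->] := S_generates y.
  rewrite linear_sum big1 // => q _; apply: contrapT => fq; apply: na.
  exists q.1; apply/eqP => E; apply: fq.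
  exact: (congr1 (fun h : {linear S -> S} => h q.2) E).
have [t fat] := comod_endo_unit fa.
have E : mor_comp f (comod_comp a t : mor (S : Cat) Y) = comod_id S.
  by rewrite -fat; apply: comodHom_ext.
exists (comod_comp a t); split=> //.
apply: fmono; apply: comodHom_ext => z.
exact: (congr1 (fun h : comodHom S S => sval h (sval (f : comodHom Y S) z)) E).
Qed.

(** A basis [F] of colinear maps exhibits [M] as a coproduct of copies of [S] indexed by [F]:
    [basis_lift] gives existence and spanning gives uniqueness. *)
Lemma comod_semisimple (M : Cat) : semisimple_obj M.
Proof.
have [F [_ Fc indF span]] := basis_extend (sub0set _) (@independent0 M).
pose i (j : {f | F f}) : comodHom S M := exist _ (sval j) (Fc _ (svalP j)).
exists {f | F f}, (fun=> S : Cat), i; split=> [_|W f]; first exact: generator_simple.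
pose g (h : {linear S -> M}) : comodHom S W :=
  if pselect (F h) is left Fh then f (exist _ h Fh) else comodHom0 S W.
have gE j : g (sval j) = f j.
  rewrite /g; case: pselect => [Fj|]; last by case; apply: (svalP j).
  by congr f; case: j Fj => h Fh Fj; congr exist; apply: Prop_irrelevance.
have [h hE] := basis_lift g Fc indF span.
exists h; split=> [j|k hk].
  by apply: comodHom_ext => y; rewrite -gE -hE //; apply: (svalP j).
apply: (comodHom_eq_on span) => u y Fu.
rewrite hE // (gE (exist _ u Fu)) -hk.
by [].
Qed.

Lemma generator_cosemisimple : cosemisimple D.
Proof. by split; [exact: comod_category_abelian|exact: comod_semisimple]. Qed.

End Cosemisimplicity.

(** * The correspondence *)

Section MainStatement.
Variables (K : comPzRingType) (A : algType K) (Sigma : lmodType A^c).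
Local Notation End := {linear Sigma -> Sigma}.
Variables (d : dual_basis Sigma) (B : set End) (hB : is_subring B).
Hypothesis simpleS : simple_module Sigma.
Local Notation C := (comatrix_coring d hB).

Lemma quot_proj_surj (J : set C) (hJ : coideal J) c : exists u, quot_proj hJ u = c.
Proof. by exists (qrepr c); apply: qreprK. Qed.

Lemma quot_proj_eq0 (J : set C) (hJ : coideal J) c : quot_proj hJ c = 0 <-> J c.
Proof.
rewrite -(linear0 (quot_proj hJ)).
by split=> [/qpiP|Jc]; [rewrite subr0|apply/qpiP; rewrite subr0].
Qed.

Lemma quot_endo_intermediate (J : set C) (hJ : coideal J) :
  intermediate_division_subring B (quot_endo hJ).
Proof. by have [] := qend_division (quot_proj hJ) simpleS. Qed.

Lemma cmx_ker_quot_endo (J : set C) (hJ : coideal J) c :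
  quot_proj hJ c = 0 <-> cmx_ker (quot_endo hJ) c.
Proof.
split; first exact: (ker_qend (quot_proj_surj (hJ := hJ)) simpleS).
exact: (@qend_ker _ _ _ _ _ _ _ (quot_proj hJ) simpleS).
Qed.

Lemma quot_coring_simple_cosemisimple (J : set C) (hJ : coideal J) :
  simple_cosemisimple (quot_coring hJ).
Proof.
split; first exact: (qcoring_simple (quot_proj_surj (hJ := hJ)) simpleS).
have [BT divT] := quot_endo_intermediate hJ.
apply: (generator_cosemisimple (S := qcomod (quot_proj hJ)) simpleS) => M m.
exact: (qcomod_generates (quot_proj_surj (hJ := hJ)) divT BT (cmx_ker_quot_endo hJ)).
Qed.

(** * The projection between comatrix corings as a coring homomorphism *)

Section Coideal.
Variables (T : set End) (hT : is_subring T) (BT : (B `<=` T)%classic).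
Local Notation CT := (comatrix_coring d hT).

Lemma cmx_proj_is_linear : linear (@cmx_proj _ _ Sigma B T : C -> CT).
Proof.
move=> a u v; rewrite cmx_projD //; congr (_ + _).
apply: (@cmx_eq K A Sigma B _ (fun u : C => cmx_proj T (ract u a) : cmx T)
   (fun u => ract (cmx_proj T u : cmx T) a)) => [x y|x y|phi x].
- by rewrite ractDl cmx_projD.
- by rewrite cmx_projD // ractDl.
- by rewrite cmx_ract !cmx_projE // cmx_ract.
Qed.
HB.instance Definition _ := GRing.isLinear.Build A^c C CT *:%R
  (@cmx_proj _ _ Sigma B T : C -> CT) cmx_proj_is_linear.

Lemma cmx_proj_lact a (u : C) :
  (cmx_proj T (lact a u) : CT) = lact a (cmx_proj T u : CT).
Proof.
apply: (@cmx_eq K A Sigma B _ (fun u : C => cmx_proj T (lact a u) : CT)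
   (fun u => lact a (cmx_proj T u : CT))) => [x y|x y|phi x].
- by rewrite lactDr cmx_projD.
- by rewrite cmx_projD // lactDr.
- by rewrite cmx_bimod_lact !cmx_projE // [RHS]cmx_bimod_lact.
Qed.

Definition cmx_proj_bimod : bimodHom C CT :=
  @BimodHom K A C CT (@cmx_proj _ _ Sigma B T : C -> CT) cmx_proj_lact.

Lemma cmx_proj_comul c : comul CT (cmx_proj_bimod c) =
  tmap cmx_proj_bimod cmx_proj_bimod (comul C c).
Proof.
have hD := tmap_rlD (rlin_linear cmx_proj_bimod) (llin_bimod cmx_proj_bimod).
apply: (@cmx_eq K A Sigma B _ (fun c => comul CT (cmx_proj_bimod c))
   (fun c => tmap cmx_proj_bimod cmx_proj_bimod (comul C c))) => [x y|x y|phi x].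
- by rewrite !linearD.
- by rewrite linearD hD.
have E psi y : cmx_proj_bimod (tpure psi y : cmx B) = (tpure psi y : cmx T).
  exact: cmx_projE.
rewrite [X in comul CT X]E [LHS]cmx_comulE [comul C _]cmx_comulE (additive_big _ _ _ hD).
apply: eq_bigr => i _.
rewrite (tmap_rlE _ _ (rlin_linear cmx_proj_bimod) (llin_bimod cmx_proj_bimod)).
by congr (tpure _ _); rewrite E.
Qed.

Lemma cmx_proj_counit c : counit CT (cmx_proj_bimod c) = counit C c.
Proof.
apply: (@cmx_eq K A Sigma B _ (fun c => counit CT (cmx_proj_bimod c)) (counit C))
  => [x y|x y|phi x].
- by rewrite !linearD.
- by rewrite linearD.
by rewrite -[cmx_proj_bimod _]/(cmx_proj T _) cmx_projE // [LHS]cmx_counitE [RHS]cmx_counitE.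
Qed.

(** The two comatrix corings share the dual basis [d], so the projection respects comultiplication
    term by term; it is onto because pure tensors lift. *)
Lemma cmx_ker_coideal : coideal (cmx_ker T : set C).
Proof.
exists CT, (CoringHom cmx_proj_comul cmx_proj_counit); split=> // c.
elim/tens_ind: c => [|u v [u' <-] [v' <-]|phi x].
- by exists 0; rewrite linear0.
- by exists (u' + v'); rewrite linearD.
- by exists (tpure phi x : cmx B); apply: cmx_projE.
Qed.

End Coideal.

End MainStatement.

Theorem mainTheorem3 (K : comPzRingType) (A : algType K)
    (Sigma : lmodType A^c)
    (hfg : finitely_generated Sigma) (hproj : projective Sigma)
    (hsimple : simple_module Sigma)
    (B : set {linear Sigma -> Sigma}) (hB : is_subring B) :
  let C := comatrix_coring (dual_basis_of hfg hproj) hB in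
  (forall (J : set C) (hJ : coideal J), simple_cosemisimple (quot_coring hJ)) /\
  [/\ forall (J : set C) (hJ : coideal J),
        intermediate_division_subring B (quot_endo hJ),
      forall T : set {linear Sigma -> Sigma},
        intermediate_division_subring B T -> coideal (cmx_ker T : set C),
      forall (J : set C) (hJ : coideal J),
        (cmx_ker (quot_endo hJ) : set C) = J
    & forall (T : set {linear Sigma -> Sigma})
             (hT : intermediate_division_subring B T)
             (hker : coideal (cmx_ker T : set C)),
        quot_endo hker = T].
Proof.
move=> C; split; first by move=> J hJ; apply: quot_coring_simple_cosemisimple.
split=> [J hJ|T [BT [hT _ _]]|J hJ|T [BT divT] hker].
- exact: quot_endo_intermediate.
- exact: (cmx_ker_coideal _ _ hT BT).
- apply/seteqP; split=> c.
    by move/cmx_ker_quot_endo => /(_ hsimple)/quot_proj_eq0.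
  by move=> Jc; apply/(cmx_ker_quot_endo hsimple)/quot_proj_eq0.
(* [quot_proj_eq0] identifies the kernel of the quotient map with [cmx_ker T], as [qend_eq]
   requires. *)
- exact: (qend_eq (quot_proj_surj (hJ := hker)) hsimple divT BT (quot_proj_eq0 hker)).
Qed.
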